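(* Let $(M,g_M,\sigma_M)$ be a magnetic system and let $N\subset M$ be a closed, embedded submanifold. Denote by $\iota:N\to M$ the inclusion and set $g_N:=\iota^*g_M$, $\sigma_N:=\iota^*\sigma_M$. The following statements are equivalent: \begin{enumerate} \item $N$ is totally magnetic in $(M,g_M,\sigma_M)$. \item If $\gamma$ is a magnetic geodesic in $(N,g_N,\sigma_N)$, then $\iota\circ\gamma$ is a magnetic geodesic in $(M,g_M,\sigma_M)$. \item The second fundamental form of $(N,g_N)$ vanishes identically, i.e. $\mathrm{II}_q(v)=0$ for all $(q,v)\in TN$, and one of the following three equivalent conditions holds: \begin{enumerate} \item the Lorentz force $Y^M$ of $(M,g_M,\sigma_M)$ along $N$ equals the Lorentz force $Y^N$ of $(N,g_N,\sigma_N)$: $Y^N_qv=Y^M_qv$ for all $(q,v)\in TN$; \item $Y^M$ leaves the tangent bundle of $N$ invariant: $Y^M_qv\in TN$ for all $(q,v)\in TN$; \item the $g_M$-orthogonal of $TN$ is contained in the $\sigma_M$-orthogonal of $TN$: $(\sigma_M)_q(u,v)=0$ for all $q\in N$, $u\in T_qN$, $v\in T_qN^\perp$. \end{enumerate} \end{enumerate}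
   Context: A magnetic system $(M,g,\sigma)$ is a closed connected Riemannian manifold $(M,g)$ with a closed two-form $\sigma$. The Lorentz force $Y:TM\to TM$ is the bundle endomorphism with $g_q(Y_qu,v)=\sigma_q(u,v)$ for all $u,v\in T_qM$. A smooth curve $\gamma$ is a magnetic geodesic of $(M,g,\sigma)$ if $\nabla_{\dot\gamma}\dot\gamma=Y_\gamma\dot\gamma$, with $\nabla$ the Levi-Civita connection of $g$. The same definitions are used for $(N,g_N,\sigma_N)$. An embedded submanifold $N\subset M$ is totally magnetic if for every magnetic geodesic $\gamma:I\to M$ of $(M,g_M,\sigma_M)$ with $\gamma(0)\in N$ and $\dot\gamma(0)\in T_{\gamma(0)}N$ there exists $\varepsilon>0$ such that $\gamma((-\varepsilon,\varepsilon))\subset N$. The second fundamental form is $\mathrm{II}_q:T_qN\to T_qN^\perp$, $\mathrm{II}_q(v):=\nabla^M_vV-\nabla^N_vV$, where $V$ is any local extension of $v$ to a vector field tangent to $N$, and $\nabla^M,\nabla^N$ are the Levi-Civita connections of $g_M,g_N$; $T_qN^\perp$ is the $g_M$-orthogonal complement of $T_qN$ in $T_qM$. *)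

(* Defs.v *)
From mathcomp Require Import all_boot all_order all_algebra.
From mathcomp Require Import all_classical all_reals all_analysis.
From mathcomp Require Import ring.
Set Implicit Arguments.
Unset Strict Implicit.
Unset Printing Implicit Defensive.
Import Order.TTheory GRing.Theory Num.Theory.
Import numFieldNormedType.Exports.
Local Open Scope classical_set_scope.
Local Open Scope ring_scope.

(** Vectors are row vectors and a linear map acts on the right, following
    ['J f p]: the differential of [f] at [p] sends [v] to [v *m 'J f p]. *)

Section Calculus.
Context {R : realType}.

(* Meaningful for [U] open and [V] finite-dimensional (below, [V] is [R] or
   [R^n]), where continuity of all [x |-> 'D_v f x] is continuity of the
   differential. *)
Fixpoint Ck_on (V W : normedModType R) (k : nat) (U : set V) (f : V -> W) :
    Prop :=
  match k with
  | 0 => forall x, U x -> {for x, continuous f}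
  | k'.+1 => (forall x, U x -> differentiable f x) /\
             (forall v, Ck_on k' U (fun x => 'D_v f x))
  end.

Definition smooth_on (V W : normedModType R) (U : set V) (f : V -> W) : Prop :=
  forall k, Ck_on k U f.

Definition partial n (i : 'I_n) (f : 'rV[R]_n -> R) (x : 'rV[R]_n) : R :=
  'D_(delta_mx 0 i) f x.

Definition bform n (B : 'M[R]_n) (u v : 'rV[R]_n) : R :=
  (u *m B *m v^T) 0 0.

(* [christoffel G x i j l] is Gamma_ij^l for the Gram matrix field [G]. *)
Definition christoffel n (G : 'rV[R]_n -> 'M[R]_n) (x : 'rV[R]_n)
    (i j l : 'I_n) : R :=
  2^-1 * \sum_(h < n)
    (partial i (fun y => G y j h) x + partial j (fun y => G y i h) x
     - partial h (fun y => G y i j) x) * invmx (G x) h l.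

Definition christoffel_apply n (G : 'rV[R]_n -> 'M[R]_n) (x u v : 'rV[R]_n) :
    'rV[R]_n :=
  \row_l \sum_(i < n) \sum_(j < n) u 0 i * v 0 j * christoffel G x i j l.

(* The next two lemmas say that [christoffel G] is the torsion-free metric
   connection of [G]. *)
Lemma christoffel_torsion_free n (G : 'rV[R]_n -> 'M[R]_n) x i j l :
  (forall y, (G y)^T = G y) -> christoffel G x i j l = christoffel G x j i l.
Proof.
move=> Gsym; rewrite /christoffel; congr (_ * _); apply: eq_bigr => h _.
congr (_ * _); rewrite [in RHS](addrC (partial j _ _)); congr (_ - _).
by congr partial; apply/funext => y; rewrite -{1}(Gsym y) mxE.
Qed.

Lemma christoffel_metric n (G : 'rV[R]_n -> 'M[R]_n) x i j l :
  (forall y, (G y)^T = G y) -> G x \in unitmx ->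
  partial l (fun y => G y i j) x =
    \sum_(h < n) christoffel G x l i h * G x h j
    + \sum_(h < n) christoffel G x l j h * G x i h.
Proof.
move=> Gsym Gu.
have Gs y a b : G y a b = G y b a by rewrite -{1}(Gsym y) mxE.
have pG a b c : partial c (fun y => G y a b) x = partial c (fun y => G y b a) x.
  by congr partial; apply/funext => y; exact: Gs.
have low a b c : \sum_(h < n) christoffel G x a b h * G x h c =
    2^-1 * (partial a (fun y => G y b c) x + partial b (fun y => G y a c) x
     - partial c (fun y => G y a b) x).
  under eq_bigr do rewrite -mulrA mulr_suml.
  rewrite -mulr_sumr exchange_big /=; congr (_ * _).
  under eq_bigr do under eq_bigr do rewrite -mulrA.
  under eq_bigr do rewrite -mulr_sumr.
  have inv h : \sum_(e < n) invmx (G x) h e * G x e c = (h == c)%:R.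
    by have /matrixP/(_ h c) := mulVmx Gu; rewrite !mxE.
  under eq_bigr do rewrite inv.
  rewrite (bigD1 c) //= eqxx mulr1 big1 ?addr0 // => h /negPf ->.
  by rewrite mulr0.
under [X in _ = _ + X]eq_bigr do rewrite Gs.
rewrite !low (pG j i).
by field.
Qed.

End Calculus.

Section SmoothStructure.
Context {R : realType}.

(* [cmap] and [cinv] are only meaningful on [cdom] and [cmap @` cdom]. *)
Record chart (M : topologicalType) (n : nat) := Chart {
  cdom : set M;
  cmap :> M -> 'rV[R]_n;
  cinv : 'rV[R]_n -> M;
  cdom_open : open cdom;
  cimg_open : open (cmap @` cdom);
  cmapK : forall p, cdom p -> cinv (cmap p) = p;
  cmap_continuous : forall p, cdom p -> {for p, continuous cmap};
  cinv_continuous :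
    forall x, (cmap @` cdom) x -> {for x, continuous cinv} }.

Definition cimg (M : topologicalType) n (c : chart M n) : set 'rV[R]_n :=
  c @` cdom c.

Definition compatible (M : topologicalType) n (c d : chart M n) : Prop :=
  smooth_on (c @` (cdom c `&` cdom d)) (d \o cinv c) /\
  smooth_on (d @` (cdom c `&` cdom d)) (c \o cinv d).

Record smooth_structure (M : topologicalType) (n : nat) := SmoothStructure {
  atlas : set (chart M n);
  atlas_cover : forall p, exists c, atlas c /\ cdom c p;
  atlas_compatible : forall c d, atlas c -> atlas d -> compatible c d;
  atlas_maximal : forall c,
    (forall d, atlas d -> compatible c d) -> atlas c }.

End SmoothStructure.

(** The tangent space T_pM is R^n, in the coordinates of the preferred chart
    [chart_at S p] around [p]. A vector field is thus a map [M -> 'rV_n], an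
    endomorphism of TM or a field of bilinear forms is a map [M -> 'M_n], and
    everything below is independent of the choice of [chart_at]. *)

Section Manifold.
Context {R : realType} {M : topologicalType} {n : nat}.
Variable S : @smooth_structure R M n.

Definition chart_at (p : M) : chart M n := projT1 (cid (atlas_cover S p)).

(* The differential at [p] of the chart [c], from T_pM to R^n. *)
Definition dchart (c : chart M n) (p : M) : 'M[R]_n :=
  'J (c \o cinv (chart_at p)) (chart_at p p).

(* Row [i] is the coordinate vector d/dx^i of [c], in T_pM for
   [p = cinv c x]. *)
Definition coord_frame (c : chart M n) (x : 'rV[R]_n) : 'M[R]_n :=
  'J (chart_at (cinv c x) \o cinv c) x.

Definition vf_coord (c : chart M n) (V : M -> 'rV[R]_n) (x : 'rV[R]_n) :
    'rV[R]_n :=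
  V (cinv c x) *m dchart c (cinv c x).

Definition bform_coord (c : chart M n) (B : M -> 'M[R]_n) (x : 'rV[R]_n) :
    'M[R]_n :=
  coord_frame c x *m B (cinv c x) *m (coord_frame c x)^T.

Definition smooth_vf_on (U : set M) (V : M -> 'rV[R]_n) : Prop :=
  forall c, atlas S c -> smooth_on (c @` (cdom c `&` U)) (vf_coord c V).

Definition smooth_bform (B : M -> 'M[R]_n) : Prop :=
  forall c, atlas S c -> smooth_on (cimg c) (bform_coord c B).

Definition riemannian_metric (g : M -> 'M[R]_n) : Prop :=
  [/\ smooth_bform g,
      forall p, (g p)^T = g p &
      forall p u, u != 0 -> 0 < bform (g p) u u].

Definition closed_two_form (s : M -> 'M[R]_n) : Prop :=
  [/\ smooth_bform s,
      forall p, (s p)^T = - s p &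
      forall c, atlas S c -> forall x, cimg c x -> forall i j l : 'I_n,
        partial i (fun y => bform_coord c s y j l) x
        + partial j (fun y => bform_coord c s y l i) x
        + partial l (fun y => bform_coord c s y i j) x = 0].

(* The Levi-Civita covariant derivative of [V] at [p] in the direction [v]. *)
Definition covariant_derivative (g : M -> 'M[R]_n) (V : M -> 'rV[R]_n)
    (p : M) (v : 'rV[R]_n) : 'rV[R]_n :=
  let c := chart_at p in
  'D_v (vf_coord c V) (c p)
  + christoffel_apply (bform_coord c g) (c p) v (V p).

Definition smooth_curve_on (I : set R) (gamma : R -> M) : Prop :=
  (forall t, I t -> {for t, continuous gamma}) /\
  (forall c, atlas S c ->
     smooth_on (I `&` gamma @^-1` cdom c) (c \o gamma : R -> 'rV[R]_n)).

Definition velocity (gamma : R -> M) (t : R) : 'rV[R]_n :=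
  derive1 (chart_at (gamma t) \o gamma) t.

(* The covariant derivative of the velocity along the curve. *)
Definition acceleration (g : M -> 'M[R]_n) (gamma : R -> M) (t : R) :
    'rV[R]_n :=
  let c := chart_at (gamma t) in
  derive1 (derive1 (c \o gamma)) t
  + christoffel_apply (bform_coord c g) (c (gamma t))
      (velocity gamma t) (velocity gamma t).

(* The condition determines [Y] when [g p] is positive definite. *)
Definition lorentz_force (g s : M -> 'M[R]_n) (p : M) : 'M[R]_n :=
  xget 0 [set Y : 'M[R]_n |
    forall u v, bform (g p) (u *m Y) v = bform (s p) u v].

Definition magnetic_geodesic (g s : M -> 'M[R]_n) (I : set R)
    (gamma : R -> M) : Prop :=
  [/\ open I, is_interval I, smooth_curve_on I gamma &
      forall t, I t ->
        acceleration g gamma t = velocity gamma t *m lorentz_force g s (gamma t)].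

End Manifold.

Section Submanifold.
Context {R : realType} {M : topologicalType} {k m : nat}.
Variable SM : @smooth_structure R M (k + m).
Variable N : set M.
(* [set_type N] carries the subspace topology. *)
Variable SN : @smooth_structure R (set_type N) k.

(* Around each point of [N] there is a chart [c] of [M] in which [N] is the
   slice R^k x 0 and whose first [k] coordinates form a chart of [N]. *)
Definition embedded_submanifold : Prop :=
  forall q : set_type N, exists c, exists b,
    [/\ atlas SM c, atlas SN b, cdom c (set_val q),
        (forall p, cdom c p -> (N p <-> rsubmx (c p) = 0)) &
        forall p : set_type N,
          (cdom b p <-> cdom c (set_val p)) /\
          (cdom b p -> b p = lsubmx (c (set_val p)))].

(* The differential at [q] of the inclusion. *)
Definition dincl (q : set_type N) : 'M[R]_(k, k + m) :=
  'J (chart_at SM (set_val q) \o set_val \o cinv (chart_at SN q))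
     (chart_at SN q q).

Definition pullback (B : M -> 'M[R]_(k + m)) (q : set_type N) : 'M[R]_k :=
  dincl q *m B (set_val q) *m (dincl q)^T.

Definition tangent (q : set_type N) : set 'rV[R]_(k + m) :=
  range (fun u : 'rV[R]_k => u *m dincl q).

Definition orthogonal_tangent (g : M -> 'M[R]_(k + m)) (q : set_type N) :
    set 'rV[R]_(k + m) :=
  [set v | forall w, tangent q w -> bform (g (set_val q)) w v = 0].

(* [V] is a local extension of [v] to a vector field of [M] tangent to [N],
   and [W] is its restriction, as a vector field of [N]. *)
Definition tangent_extension (q : set_type N) (v : 'rV[R]_k)
    (V : M -> 'rV[R]_(k + m)) (W : set_type N -> 'rV[R]_k) : Prop :=
  W q = v /\
  exists U : set M, [/\ open U, U (set_val q), smooth_vf_on SM U V &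
    forall p : set_type N, U (set_val p) -> V (set_val p) = W p *m dincl p].

(* An extension always exists and [w] depends only on [v]; [0] is the default
   value required by [xget]. *)
Definition second_fundamental_form (g : M -> 'M[R]_(k + m)) (q : set_type N)
    (v : 'rV[R]_k) : 'rV[R]_(k + m) :=
  xget 0 [set w | exists V W, tangent_extension q v V W /\
    w = covariant_derivative SM g V (set_val q) (v *m dincl q)
        - covariant_derivative SN (pullback g) W q v *m dincl q].

Definition totally_magnetic (g s : M -> 'M[R]_(k + m)) : Prop :=
  forall (I : set R) (gamma : R -> M), magnetic_geodesic SM g s I gamma ->
    I 0 ->
    (exists2 q : set_type N, set_val q = gamma 0 &
       tangent q (velocity SM gamma 0)) ->
    exists2 e : R, 0 < e &
      forall t, - e < t < e -> I t /\ N (gamma t).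

End Submanifold.

(* Main.v *)
From HB Require Import structures.
Require Import Defs.
From mathcomp Require Import all_boot all_order all_algebra.
From mathcomp Require Import all_classical all_reals all_analysis.
From mathcomp Require Import ring lra.
Set Implicit Arguments.
Unset Strict Implicit.
Unset Printing Implicit Defensive.
Import Order.TTheory GRing.Theory Num.Theory.
Import numFieldNormedType.Exports.
Local Open Scope classical_set_scope.
Local Open Scope ring_scope.

(** In a chart, a magnetic geodesic solves x'' = x' Y(x) - Gamma(x)(x', x')
    ([mag_field]). Let [D] be the differential of the inclusion of N, let
    II be the second fundamental form, and write Y_M, Y_N for the Lorentz
    forces, matrices acting on row vectors from the right.

    The geometry is contained in one statement about curves, the Gauss
    formula: if a curve of N has acceleration [a] and velocity [v] in N, its
    acceleration in M is [a D + II(v)], and [II(v)] is orthogonal to N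
    ([coord_acc_comp], [sff_map_orthogonal]). It is proved for a map [phi]
    between coordinate domains that pulls one Gram matrix back to another,
    as a consequence of Koszul's formula and of the symmetry of second
    derivatives. When [phi] is the inclusion of N it is the Gauss formula;
    when [phi] is a change of charts there are no normal directions, so
    II vanishes and the formula says that the acceleration of a curve does
    not depend on the chart.

    The three forms of the condition on the Lorentz force are linear algebra:
    Y_N is the tangential part of Y_M ([lorentz_tangential]), so
    [v Y_N D - v D Y_M] is normal, and its square norm is, up to sign, the
    value of the two-form on a tangent and a normal vector.

    Suppose that the magnetic geodesic of M with a given initial velocity [v]
    tangent to N is a curve of N, either because N is totally magnetic
    ([totally_magnetic_decomposition]) or because it comes from a magnetic
    geodesic of N ([geodesics_included_decomposition]). By the Gauss formula
    [v D Y_M = a D + II(v)] for some [a], so [II(v)] is the normal part of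
    [v D Y_M]. The left-hand side is even in [v] and the right-hand side is
    odd, so both vanish ([normal_decomposition]): N is totally geodesic and
    Y_M preserves the tangent bundle of N. Conversely these two properties
    turn the equation of magnetic geodesics of N into that of M
    ([geodesics_included_of_extrinsic]).

    It remains to see that N is totally magnetic when its magnetic geodesics
    are magnetic geodesics of M. In a slice chart, where N is given by the
    vanishing of the last [m] coordinates, the magnetic geodesics of N
    through all points and in all directions show that the right-hand side
    of the equation is tangent to N along N ([slice_mag_field]). The last
    [m] coordinates [w] of a magnetic geodesic of M then satisfy
    [|w''| <= L |(w, w')|], so they stay zero if they start with
    [w = w' = 0] ([second_order_invariant]).

    Existence of magnetic geodesics is the Picard-Lindeloef theorem
    ([picard_lindeloef], [magnetic_geodesic_exists]); that its solutions are
    smooth rests on the calculus of the class [Ck_on], stable under sums,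
    products, composition and inversion of matrices. *)

(** * Functions of class C^k and Jacobian matrices *)

Section CkCalculus.
Context {R : realType}.
Implicit Types V W : normedModType R.

(** This expansion characterizes the differential of [g], so differentiability
    depends only on the germ of the function. *)
Lemma near_eq_diff_locally V W (f g : V -> W) x :
  (\forall y \near x, f y = g y) -> differentiable f x ->
  g \o shift x = cst (g x) + 'd f x +o_ 0 id.
Proof.
move=> fg df; have fgx := nbhs_singleton fg.
have := diff_locally df; rewrite -fgx => /eqaddoP df0.
apply/eqaddoP => e e0; have := df0 _ e0; rewrite !near_simpl => h.
have fg0 : \forall y \near 0, f (y + x) = g (y + x).
  by move: fg; rewrite (near_shift 0 x) /= => fg; apply: filterS fg => y /=; rewrite subr0.
apply: filterS2 fg0 h => y fgy.
by rewrite -[X in _ -> `|X| <= _]/(g (y + x) - (f x + 'd f x y)) -fgy.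
Qed.

Lemma near_eq_differentiable V W (f g : V -> W) x :
  (\forall y \near x, f y = g y) -> differentiable f x -> differentiable g x.
Proof.
move=> fg df; have h := near_eq_diff_locally fg df.
apply/diff_locallyP; have dfc := diff_continuous df.
by rewrite (diff_unique dfc h).
Qed.

(** Every clause of [Ck_on] concerns one point of [U] at a time. Smoothness
    can thus be checked with a different neighbourhood, hence with a different
    chart, at each point. *)
Lemma Ck_onP V W k (U : set V) (f : V -> W) :
  Ck_on k U f <-> forall x, U x -> Ck_on k [set x] f.
Proof.
elim: k f => [|k IH] f /=.
  split=> [h x Ux y ->|h x Ux]; [exact: h|exact: (h x Ux x erefl)].
split=> [[df h] x Ux|h]; split.
- by move=> y ->; exact: df.
- by move=> v; exact: (IH _).1 (h v) x Ux.
- by move=> x Ux; exact: (h x Ux).1.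
- by move=> v; apply/IH => x Ux; exact: (h x Ux).2.
Qed.

Lemma Ck_on_subset V W k (U U' : set V) (f : V -> W) :
  U' `<=` U -> Ck_on k U f -> Ck_on k U' f.
Proof. by move=> s /Ck_onP h; apply/Ck_onP => x /s; exact: h. Qed.

Lemma Ck_on_eq V W k (U : set V) (f g : V -> W) : open U ->
  (forall x, U x -> f x = g x) -> Ck_on k U f -> Ck_on k U g.
Proof.
move=> oU; elim: k f g => [|k IH] f g fg /=.
  move=> cf x Ux; have fgx : \forall y \near x, f y = g y.
    by near=> y; apply: fg; near: y; exact: open_nbhs_nbhs.
  have := cf x Ux; rewrite /prop_for /continuous_at (fg _ Ux); apply: cvg_trans.
  by apply: near_eq_cvg; apply: filterS fgx.
have near_fg x : U x -> \forall y \near x, f y = g y.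
  by move=> Ux; near=> y; apply: fg; near: y; exact: open_nbhs_nbhs.
move=> [df h]; split=> [x Ux|v].
  exact: near_eq_differentiable (near_fg x Ux) (df x Ux).
by apply: IH (h v) => x Ux; exact: near_eq_derive (near_fg x Ux).
Unshelve. all: by end_near. Qed.

Lemma Ck_onW V W k (U : set V) (f : V -> W) : Ck_on k.+1 U f -> Ck_on k U f.
Proof.
elim: k f => [|k IH] f /= [df h].
  by move=> x Ux; exact/differentiable_continuous/df.
by split=> // v; apply: IH; exact: h.
Qed.

Lemma Ck_on_cst V W k (U : set V) (a : W) : Ck_on k U (fun=> a).
Proof.
elim: k a => [|k IH] a /=; first by move=> x _; exact: cst_continuous.
split=> [x _|v]; first exact: differentiable_cst.
rewrite (_ : (fun x => 'D_v _ x) = fun=> 0); first exact: IH.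
by apply/funext => x; exact: derive_cst.
Qed.

(** Allows functions that are only known to be linear, such as entries and
    blocks of a matrix, to be used with the results on bundled linear maps. *)
Lemma linear_bundle V W (L : V -> W) : linear L ->
  exists L' : {linear V -> W}, L = L' :> (V -> W).
Proof.
move=> linL; pose LM := GRing.isLinear.Build _ _ _ _ _ linL.
by exists (HB.pack L LM : {linear V -> W}).
Qed.

Lemma linear_derive V W (L : V -> W) x v : linear L -> continuous L ->
  differentiable L x /\ 'D_v L x = L v.
Proof.
move=> /linear_bundle[{}L ->] cL; have dL := linear_differentiable x cL.
by split=> //; rewrite deriveE // diff_lin.
Qed.

Lemma Ck_on_linear V W k (U : set V) (L : V -> W) :
  linear L -> continuous L -> Ck_on k U L.
Proof.
move=> linL cL; case: k => [|k] /=; first by move=> x _; exact: cL.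
split=> [x _|v]; first exact: (linear_derive x 0 linL cL).1.
rewrite (_ : (fun x => 'D_v L x) = fun=> L v); first exact: Ck_on_cst.
by apply/funext => x; exact: (linear_derive x v linL cL).2.
Qed.

Lemma Ck_on_linear_comp V W W' k (U : set V) (f : V -> W) (L : W -> W') :
  open U -> linear L -> continuous L -> Ck_on k U f ->
  Ck_on k U (fun x => L (f x)).
Proof.
move=> oU /linear_bundle[{}L ->] cL; elim: k f => [|k IH] f /=.
  by move=> cf x Ux; apply: continuous_comp; [exact: cf|exact: cL].
move=> [df h]; split=> [x Ux|v].
  by apply: differentiable_comp; [exact: df|exact: linear_differentiable].
apply: Ck_on_eq (IH _ (h v)) => // x Ux /=.
have dL := linear_differentiable (f x) cL.
rewrite [RHS]deriveE; last by apply: differentiable_comp => //; exact: df.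
by rewrite diff_comp //=; [rewrite deriveE ?diff_lin //|]; exact: df.
Qed.

Lemma Ck_onD V W k (U : set V) (f g : V -> W) : open U ->
  Ck_on k U f -> Ck_on k U g -> Ck_on k U (fun x => f x + g x).
Proof.
move=> oU; elim: k f g => [|k IH] f g /=.
  by move=> cf cg x Ux; apply: continuousD; [exact: cf|exact: cg].
move=> [df hf] [dg hg]; split=> [x Ux|v].
  by apply: differentiableD; [exact: df|exact: dg].
apply: Ck_on_eq (IH _ _ (hf v) (hg v)) => // x Ux.
by rewrite deriveD //; apply: diff_derivable; [exact: df|exact: dg].
Qed.

Lemma Ck_on_sum V W (I : Type) (r : seq I) (P : pred I) k (U : set V)
    (f : I -> V -> W) :
  open U -> (forall i, Ck_on k U (f i)) ->
  Ck_on k U (fun x => \sum_(i <- r | P i) f i x).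
Proof.
move=> oU hf; elim: r => [|i r IH].
  by under eq_fun do rewrite big_nil; exact: Ck_on_cst.
under eq_fun do rewrite big_cons.
by case: (P i) => //; exact: Ck_onD.
Qed.

Lemma Ck_onM V k (U : set V) (f g : V -> R) : open U ->
  Ck_on k U f -> Ck_on k U g -> Ck_on k U (fun x => f x * g x).
Proof.
move=> oU; elim: k f g => [|k IH] f g.
  by move=> cf cg x Ux; apply: continuousM; [exact: cf|exact: cg].
move=> hf hg; split=> [x Ux|v].
  by apply: differentiableM; [exact: hf.1|exact: hg.1].
have := Ck_onD oU (IH _ _ (Ck_onW hf) (hg.2 v)) (IH _ _ (Ck_onW hg) (hf.2 v)).
apply: Ck_on_eq => // x Ux.
by rewrite deriveM //; apply: diff_derivable; [exact: hf.1|exact: hg.1].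
Qed.

Lemma Ck_onZ V W k (U : set V) (f : V -> R) (w : W) : open U ->
  Ck_on k U f -> Ck_on k U (fun x => f x *: w).
Proof.
move=> oU; apply: (@Ck_on_linear_comp _ R W _ _ f ( *:%R ^~ w)) => //.
  by move=> a x y; rewrite scalerDl scalerA.
exact: scalel_continuous.
Qed.

(** Reduces the calculus of matrix-valued functions to that of real-valued
    ones, where products are available. *)
Lemma Ck_on_mxP V m n k (U : set V) (M : V -> 'M[R]_(m, n)) : open U ->
  Ck_on k U M <-> forall i j, Ck_on k U (fun x => M x i j).
Proof.
move=> oU; split=> [hM i j|hM].
  apply: (@Ck_on_linear_comp _ _ R _ _ M (fun A => A i j)) => //.
    by move=> a x y; rewrite !mxE.
  exact: coord_continuous.
apply: (@Ck_on_eq _ _ _ _ (fun x => \sum_i \sum_j M x i j *: delta_mx i j)) => //.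
  by move=> x _; rewrite -matrix_sum_delta.
by do 2![apply: Ck_on_sum => // ?]; apply: Ck_onZ.
Qed.

Lemma Ck_on_mulmx V m n p k (U : set V) (A : V -> 'M[R]_(m, n))
    (B : V -> 'M[R]_(n, p)) : open U ->
  Ck_on k U A -> Ck_on k U B -> Ck_on k U (fun x => A x *m B x).
Proof.
move=> oU /Ck_on_mxP hA /Ck_on_mxP hB; apply/Ck_on_mxP => // i j.
under eq_fun do rewrite mxE.
by apply: Ck_on_sum => // l; apply: Ck_onM; [|exact: hA|exact: hB].
Qed.

Lemma Ck_on_trmx V m n k (U : set V) (A : V -> 'M[R]_(m, n)) : open U ->
  Ck_on k U A -> Ck_on k U (fun x => (A x)^T).
Proof.
move=> oU /Ck_on_mxP hA; apply/Ck_on_mxP => // i j.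
by under eq_fun do rewrite mxE; exact: hA.
Qed.

(** The derivative of [g] is taken in the direction ['D_v f x], which moves
    with [x]. Expanding this direction on the canonical basis gives a sum of
    products of functions to which the induction hypothesis applies. *)
Lemma Ck_on_compR V n k (U : set V) (U' : set 'rV[R]_n) (f : V -> 'rV[R]_n)
    (g : 'rV[R]_n -> R) : open U -> (forall x, U x -> U' (f x)) ->
  Ck_on k U f -> Ck_on k U' g -> Ck_on k U (fun x => g (f x)).
Proof.
move=> oU fU; elim: k g => [|k IH] g.
  by move=> cf cg x Ux; apply: continuous_comp; [exact: cf|exact/cg/fU].
move=> hf hg; split=> [x Ux|v].
  by apply: differentiable_comp; [exact: hf.1|exact/hg.1/fU].
apply: (@Ck_on_eq _ _ _ _ (fun x =>
    \sum_(i < n) ('D_v f x) 0 i * 'D_(delta_mx 0 i) g (f x))) => // [x Ux|].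
  have dg := hg.1 _ (fU x Ux); have df := hf.1 x Ux.
  rewrite [RHS]deriveE; last exact: differentiable_comp.
  rewrite diff_comp //= -(deriveE v df) [in RHS](row_sum_delta ('D_v f x)).
  by rewrite linear_sum; apply: eq_bigr => i _; rewrite linearZ /= -deriveE.
apply: Ck_on_sum => // i; apply: Ck_onM => //.
  exact: ((Ck_on_mxP _ _ oU).1 (hf.2 v)).
exact: (IH (fun y => 'D_(delta_mx 0 i) g y) (Ck_onW hf) (hg.2 _)).
Qed.

Lemma Ck_on_comp V n p q k (U : set V) (U' : set 'rV[R]_n) (f : V -> 'rV[R]_n)
    (g : 'rV[R]_n -> 'M[R]_(p, q)) : open U -> open U' ->
  (forall x, U x -> U' (f x)) ->
  Ck_on k U f -> Ck_on k U' g -> Ck_on k U (fun x => g (f x)).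
Proof.
move=> oU oU' fU hf /Ck_on_mxP hg; apply/Ck_on_mxP => // i j.
exact: (Ck_on_compR oU fU hf (hg oU' i j)).
Qed.

Lemma Ck_onV V k (U : set V) (f : V -> R) : open U ->
  (forall x, U x -> f x != 0) -> Ck_on k U f -> Ck_on k U (fun x => (f x)^-1).
Proof.
move=> oU f0; elim: k => [|k IH] hf.
  by move=> x Ux; apply: continuousV; [exact: f0|exact: hf].
split=> [x Ux|v].
  by apply: differentiableV; [exact: hf.1|exact: f0].
have h := IH (Ck_onW hf).
apply: (@Ck_on_eq _ _ _ _ (fun x => (-1 * ((f x)^-1 * (f x)^-1)) * 'D_v f x)) => //.
  move=> x Ux; rewrite deriveV ?f0 //; last exact/diff_derivable/hf.1.
  by rewrite mulN1r -invfM.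
apply: Ck_onM => //; last exact: hf.2.
by apply: Ck_onM; [|exact: Ck_on_cst|exact: Ck_onM].
Qed.

Lemma Ck_on_det V n k (U : set V) (A : V -> 'M[R]_n) : open U ->
  Ck_on k U A -> Ck_on k U (fun x => \det (A x)).
Proof.
move=> oU /Ck_on_mxP hA.
apply: Ck_on_sum => // s; apply: Ck_onM => //; first exact: Ck_on_cst.
elim: (index_enum _) => [|i r IH].
  by under eq_fun do rewrite big_nil; exact: Ck_on_cst.
by under eq_fun do rewrite big_cons; apply: Ck_onM => //; exact: hA.
Qed.

(** Cramer's formula: the entries of the inverse are quotients of
    determinants. *)
Lemma Ck_on_invmx V n k (U : set V) (A : V -> 'M[R]_n) : open U ->
  (forall x, U x -> A x \in unitmx) -> Ck_on k U A ->
  Ck_on k U (fun x => invmx (A x)).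
Proof.
move=> oU uA hA; have /Ck_on_mxP hA' := hA.
apply: (@Ck_on_eq _ _ _ _ (fun x => (\det (A x))^-1 *: \adj (A x))) => //.
  by move=> x Ux; rewrite /invmx uA.
apply/Ck_on_mxP => // i j; under eq_fun do rewrite !mxE.
apply: Ck_onM => //.
  apply: Ck_onV; [by []|move=> x Ux|exact: Ck_on_det].
  by have := uA x Ux; rewrite unitmxE unitfE.
apply: Ck_onM => //; first exact: Ck_on_cst.
apply: Ck_on_det => //; apply/Ck_on_mxP => // a b.
by under eq_fun do rewrite !mxE; exact: hA'.
Qed.

Lemma jacobianE m n (f : 'rV[R]_m -> 'rV[R]_n) x i j : differentiable f x ->
  'J f x i j = ('D_(delta_mx 0 i) f x) 0 j.
Proof. by move=> df; rewrite deriveEjacobian // -rowE [RHS]mxE. Qed.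

Lemma Ck_on_jacobian m n k (U : set 'rV[R]_m) (f : 'rV[R]_m -> 'rV[R]_n) :
  open U -> Ck_on k.+1 U f -> Ck_on k U (fun x => 'J f x).
Proof.
move=> oU hf; apply/Ck_on_mxP => // i j.
apply: (@Ck_on_eq _ _ _ _ (fun x => ('D_(delta_mx 0 i) f x) 0 j)) => //.
  by move=> x Ux; rewrite jacobianE //; exact: hf.1.
exact: ((Ck_on_mxP _ _ oU).1 (hf.2 (delta_mx 0 i))).
Qed.

Lemma near_eq_jacobian m n (f g : 'rV[R]_m -> 'rV[R]_n) x :
  (\forall y \near x, f y = g y) -> differentiable f x -> 'J f x = 'J g x.
Proof.
move=> fg df; apply/matrixP => i j.
apply: etrans (jacobianE i j df) _.
apply: etrans _ (esym (jacobianE i j (near_eq_differentiable fg df))).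
by rewrite (near_eq_derive _ fg).
Qed.

Lemma is_derive_comp V V' W (f : V -> V') (g : V' -> W) x v :
  differentiable f x -> differentiable g (f x) ->
  is_derive x v (fun y => g (f y)) ('D_('D_v f x) g (f x)).
Proof.
move=> df dg; have dgf := differentiable_comp df dg.
split; first exact: diff_derivable.
by rewrite deriveE // diff_comp //= -!deriveE.
Qed.

Lemma jacobian_comp m n p (f : 'rV[R]_m -> 'rV[R]_n) (g : 'rV[R]_n -> 'rV[R]_p) x :
  differentiable f x -> differentiable g (f x) ->
  'J (g \o f) x = 'J f x *m 'J g (f x).
Proof.
move=> df dg; apply/row_matrixP => i; rewrite !rowE mulmxA.
apply: etrans (esym (deriveEjacobian _ (differentiable_comp df dg))) _.
have [_ d] := is_derive_comp (delta_mx 0 i) df dg; apply: etrans d _.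
apply: etrans (deriveEjacobian _ dg) _; congr (_ *m _).
exact: deriveEjacobian.
Qed.

Lemma jacobian_id m (x : 'rV[R]_m) : 'J id x = 1%:M.
Proof.
apply/row_matrixP => i; rewrite !rowE -deriveEjacobian ?derive_id ?mulmx1 //.
Qed.

Lemma is_derive_mulmx V m n p (A : V -> 'M[R]_(m, n)) (B : V -> 'M[R]_(n, p)) x v
    dA dB : is_derive x v A dA -> is_derive x v B dB ->
  is_derive x v (fun y => A y *m B y) (dA *m B x + A x *m dB).
Proof.
move=> [hA <-] [hB <-]; have hA' := (derivable_mxP _ _ _).1 hA.
have hB' := (derivable_mxP _ _ _).1 hB.
have dAB i j : is_derive x v (fun y => (A y *m B y) i j)
    (('D_v A x *m B x + A x *m 'D_v B x) i j).
  under eq_fun do rewrite mxE.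
  rewrite (_ : (fun y => _) = \sum_l (fun y => A y i l * B y l j)); last first.
    by apply/funext => y; rewrite fct_sumE.
  rewrite !mxE -big_split /=.
  apply: is_derive_sum => l.
  apply: (is_derive_eq (is_deriveM (derivableP (hA' i l)) (derivableP (hB' l j)))).
  rewrite derive_mx // derive_mx // !mxE addrC; congr (_ + _); exact: mulrC.
have d : derivable (fun y => A y *m B y) x v.
  by apply/derivable_mxP => i j; have [] := dAB i j.
split=> //; rewrite derive_mx //; apply/matrixP => i j; rewrite mxE.
by have [] := dAB i j.
Qed.

Lemma differentiable_mxP V m n (M : V -> 'M[R]_(m, n)) x :
  differentiable M x <-> forall i j, differentiable (fun y => M y i j) x.
Proof.
split=> [dM i j|dM].
  apply: (differentiable_comp dM (g := fun A : 'M[R]_(m, n) => A i j)).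
  exact: differentiable_coord.
have -> : M = \sum_i \sum_j (fun y => M y i j *: delta_mx i j).
  apply/funext => y; rewrite fct_sumE [LHS]matrix_sum_delta.
  by apply: eq_bigr => i _; rewrite fct_sumE.
by do 2![apply: differentiable_sum => ?]; exact: differentiableZl.
Qed.

Lemma differentiable_mulmx V m n p (A : V -> 'M[R]_(m, n)) (B : V -> 'M[R]_(n, p)) x :
  differentiable A x -> differentiable B x -> differentiable (fun y => A y *m B y) x.
Proof.
move=> /differentiable_mxP dA /differentiable_mxP dB; apply/differentiable_mxP => i j.
under eq_fun do rewrite mxE.
rewrite (_ : (fun y => _) = \sum_l (fun y => A y i l * B y l j)); last first.
  by apply/funext => y; rewrite fct_sumE.
by apply: differentiable_sum => l; apply: differentiableM.
Qed.

End CkCalculus.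

(** * Symmetry of second derivatives *)

Section SecondDerivatives.
Context {R : realType}.
Implicit Types V W : normedModType R.

Lemma is_derive_line V W (f : V -> W) (w u : V) (s : R) :
  differentiable f (w + s *: u) ->
  is_derive s (1 : R) (fun r : R => f (w + r *: u)) ('D_u f (w + s *: u)).
Proof.
move=> df; have dl : is_derive s (1 : R) (fun r : R => w + r *: u) u.
  split; first apply/derivableD/derivable1_diffP.
    exact: derivable_cst.
    by [].
  rewrite deriveD ?derive_cst ?add0r ?deriveE ?diff_val ?scale1r //.
  exact/derivable1_diffP.
have := @is_derive_comp _ R _ _ (fun r : R => w + r *: u) f s 1.
rewrite (derive_val (is_derive := dl)); apply=> //.
Qed.

Lemma is_derive_trmx V m n (A : V -> 'M[R]_(m, n)) x v dA : is_derive x v A dA ->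
  is_derive x v (fun y => (A y)^T) dA^T.
Proof.
move=> [hA <-]; have hA' := (derivable_mxP _ _ _).1 hA.
have d : derivable (fun y => (A y)^T) x v.
  by apply/derivable_mxP => i j; under eq_fun do rewrite mxE; exact: hA'.
split=> //; rewrite !derive_mx //; apply/matrixP => i j; rewrite !mxE.
by under eq_fun do rewrite mxE.
Qed.

Lemma near_parallelogram V (x u v : V) (P : set V) : nbhs x P ->
  exists2 h : R, 0 < h & forall s t, s \in `[0, h] -> t \in `[0, h] ->
    P (x + s *: u + t *: v).
Proof.
move=> /nbhs_ballP[r /= r0 rP]; have n0 : 0 < `|u| + `|v| + 1.
  by rewrite ltr_wpDl // addr_ge0.
exists (r / (`|u| + `|v| + 1)); first by rewrite divr_gt0.
move=> s t; rewrite !in_itv /= => /andP[s0 sh] /andP[t0 th]; apply: rP.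
rewrite -ball_normE /= -addrA opprD addrA subrr sub0r normrN.
apply: le_lt_trans (ler_normD _ _) _; rewrite !normrZ !ger0_norm //.
apply: (@le_lt_trans _ _ (r / (`|u| + `|v| + 1) * (`|u| + `|v|))).
  by rewrite mulrDr lerD // ler_wpM2r.
by rewrite mulrAC ltr_pdivrMr // ltr_pM2l // ltrDl.
Qed.

(** The mean value theorem, used once in the direction [u] and once in the
    direction [v]. The left-hand side does not change when [u] and [v] are
    exchanged. *)
Lemma second_difference V (U : set V) (f : V -> R) (x u v : V) (h : R) :
  0 < h -> Ck_on 2 U f ->
  (forall s t, s \in `[0, h] -> t \in `[0, h] -> U (x + s *: u + t *: v)) ->
  exists s, exists t, [/\ s \in `[0, h], t \in `[0, h] &
    f (x + h *: u + h *: v) - f (x + h *: u) - (f (x + h *: v) - f x) =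
    h * h * 'D_v (fun y => 'D_u f y) (x + s *: u + t *: v)].
Proof.
move=> h0 hf Uh.
have h_in : h \in `[0, h] by rewrite in_itv /= lexx ltW.
have o_in : 0 \in `[0, h] by rewrite in_itv /= lexx ltW.
have oo s : s \in `]0, h[ -> s \in `[0, h] by apply: subset_itvW.
pose g (s : R) := f (x + h *: v + s *: u) - f (x + s *: u).
have dg s : s \in `[0, h] -> is_derive s (1 : R) g
    ('D_u f (x + h *: v + s *: u) - 'D_u f (x + s *: u)).
  move=> sh; apply: is_deriveB; apply: is_derive_line; apply: hf.1.
    by rewrite addrAC; exact: Uh.
  by have := Uh s 0 sh o_in; rewrite scale0r addr0.
have cg : {within `[0, h], continuous g}.
  by apply: derivable_within_continuous => s /dg [].
have [s sh] := MVT h0 (fun s sh => dg s (oo s sh)) cg.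
rewrite subr0 => gs.
pose k (t : R) := 'D_u f (x + s *: u + t *: v).
have dk t : t \in `[0, h] -> is_derive t (1 : R) k
    ('D_v (fun y => 'D_u f y) (x + s *: u + t *: v)).
  move=> th; apply: (@is_derive_line _ _ (fun y => 'D_u f y)).
  by apply: (hf.2 u).1; apply: Uh => //; exact: oo.
have ck : {within `[0, h], continuous k}.
  by apply: derivable_within_continuous => t /dk [].
have [t th] := MVT h0 (fun t th => dk t (oo t th)) ck.
rewrite subr0 => kt; exists s, t; split; [exact: oo|exact: oo|].
move: gs; rewrite /g scale0r !addr0 [x + h *: v + _]addrAC => ->.
move: kt; rewrite /k scale0r addr0 [x + s *: u + _]addrAC => ->.
by rewrite -mulrA mulrC.
Qed.

(** If the two mixed derivatives differed at [x], their values would be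
    separated on a small parallelogram by continuity; but a second difference
    is a common value of both, taken at two points of it. *)
Lemma schwarz_real V (U : set V) (f : V -> R) (x u v : V) : open U -> U x ->
  Ck_on 2 U f ->
  'D_u (fun y => 'D_v f y) x = 'D_v (fun y => 'D_u f y) x.
Proof.
move=> oU Ux hf; apply/eqP; rewrite -subr_eq0; apply: contraT => ab.
set a := 'D_u _ x in ab *; set b := 'D_v _ x in ab *.
have e0 : 0 < `|a - b| / 2 by rewrite divr_gt0 // normr_gt0.
have ca := (hf.2 v).2 u x Ux.
have cb := (hf.2 u).2 v x Ux.
have /cvgrPdist_lt/(_ _ e0) na := ca.
have /cvgrPdist_lt/(_ _ e0) nb := cb.
have nU : nbhs x U by exact: open_nbhs_nbhs.
have [h1 h10 H1] := near_parallelogram u v (filterI nU (filterI na nb)).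
have [h2 h20 H2] := near_parallelogram v u (filterI nU (filterI na nb)).
pose h := Num.min h1 h2; have h0 : 0 < h by rewrite lt_min h10.
have hh1 s : s \in `[0, h] -> s \in `[0, h1].
  by rewrite !in_itv /= le_min => /andP[-> /andP[->]].
have hh2 s : s \in `[0, h] -> s \in `[0, h2].
  by rewrite !in_itv /= le_min => /andP[-> /andP[_ ->]].
have [s [t [/hh1 sh /hh1 th E1]]] := second_difference h0 hf
  (fun s t sh th => (H1 s t (hh1 _ sh) (hh1 _ th)).1).
have [s' [t' [/hh2 sh' /hh2 th' E2]]] := second_difference h0 hf
  (fun s t sh th => (H2 s t (hh2 _ sh) (hh2 _ th)).1).
have [_ [_ /= Hb]] := H1 s t sh th.
have [_ [/= Ha _]] := H2 s' t' sh' th'.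
have E : 'D_v (fun y => 'D_u f y) (x + s *: u + t *: v) =
         'D_u (fun y => 'D_v f y) (x + s' *: v + t' *: u).
  apply: (@mulfI _ (h * h)); first by rewrite mulf_neq0 // gt_eqF.
  by rewrite -E1 -E2 (addrAC x (h *: v)); ring.
have : `|a - b| < `|a - b|.
  rewrite [ltRHS]splitr; apply: le_lt_trans (ltrD Ha Hb).
  rewrite -E [X in _ <= _ + X]distrC; apply: le_trans (ler_normD _ _).
  by rewrite addrA subrK.
by rewrite ltxx.
Qed.

Lemma schwarz V m n (U : set V) (f : V -> 'M[R]_(m, n)) (x u v : V) :
  open U -> U x -> Ck_on 2 U f ->
  'D_u (fun y => 'D_v f y) x = 'D_v (fun y => 'D_u f y) x.
Proof.
move=> oU Ux hf; apply/matrixP => i j.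
have hij := (Ck_on_mxP _ _ oU).1 hf i j.
have E w w' : ('D_w (fun y => 'D_w' f y) x) i j =
              'D_w (fun y => 'D_w' (fun z => f z i j) y) x.
  rewrite derive_mx ?mxE; last exact/diff_derivable/(hf.2 w').1.
  apply: near_eq_derive; near=> y.
  rewrite derive_mx ?mxE //; apply/diff_derivable/hf.1.
  by near: y; exact: open_nbhs_nbhs.
apply: etrans (E u v) _; apply: etrans _ (esym (E v u)).
exact: schwarz_real hij.
Unshelve. all: by end_near. Qed.

(** The form in which the symmetry enters Koszul's formula: each side is a
    second derivative of [f] in the directions [u] and [v]. *)
Lemma jacobian_schwarz m n (U : set 'rV[R]_m) (f : 'rV[R]_m -> 'rV[R]_n) x u v :
  open U -> U x -> Ck_on 2 U f ->
  u *m 'D_v (fun y => 'J f y) x = v *m 'D_u (fun y => 'J f y) x.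
Proof.
move=> oU Ux hf.
have E w w' : w *m 'D_w' (fun y => 'J f y) x = 'D_w' (fun y => 'D_w f y) x.
  have dJ : derivable (fun y => 'J f y) x w'.
    by apply/diff_derivable; exact: (Ck_on_jacobian oU hf).1.
  have [_ /esym] := is_derive_mulmx (is_derive_cst w x w') (derivableP dJ).
  rewrite mul0mx add0r => ->; apply: near_eq_derive; near=> y.
  rewrite -deriveEjacobian //; apply: hf.1.
  by near: y; exact: open_nbhs_nbhs.
apply: etrans (E u v) _; apply: etrans _ (esym (E v u)).
exact: schwarz hf.
Unshelve. all: by end_near. Qed.

End SecondDerivatives.

(** * Mean value inequalities, limits and primitives *)

Section Estimates.
Context {R : realType}.

Lemma rV_norm_leP n (x : 'rV[R]_n) (C : R) : 0 <= C ->
  `|x| <= C <-> forall j, `|x 0 j| <= C.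
Proof.
move=> C0; split=> [h j|h].
  apply: le_trans h; rewrite [leRHS]/Num.Def.normr/= mx_normrE.
  exact: (le_bigmax _ _ (ord0, j)).
rewrite [leLHS]/Num.Def.normr/= mx_normrE; apply: bigmax_le => //= -[i j] _ /=.
by rewrite ord1.
Qed.

(** The norm of a row vector is the maximum of its entries, so the inequality
    follows from the scalar mean value theorem entry by entry, with the same
    constant. *)
Lemma mean_value_segment n (f df : R -> 'rV[R]_n) (a b C : R) :
  a <= b -> (forall s, s \in `[a, b] -> is_derive s (1 : R) f (df s)) ->
  (forall s, s \in `[a, b] -> `|df s| <= C) ->
  `|f b - f a| <= C * (b - a).
Proof.
move=> ab hf hC; have C0 : 0 <= C.
  by apply: le_trans (hC a _); rewrite ?normr_ge0 // in_itv /= lexx ab.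
apply/rV_norm_leP => [|j]; first by rewrite mulr_ge0 // subr_ge0.
have dj s : s \in `[a, b] -> is_derive s (1 : R) (fun t => f t 0 j) (df s 0 j).
  move=> /hf [d <-]; split; first exact: (derivable_mxP _ _ _).1.
  by rewrite derive_mx // mxE.
have oo s : s \in `]a, b[ -> s \in `[a, b] by apply: subset_itvW.
have cf : {within `[a, b], continuous (fun t => f t 0 j)}.
  by apply: derivable_within_continuous => s /dj [].
have [s sab] := MVT_segment ab (fun s sab => dj s (oo s sab)) cf.
rewrite !mxE => ->; rewrite normrM (ger0_norm (_ : 0 <= b - a)) ?subr_ge0 //.
by rewrite ler_wpM2r ?subr_ge0 //; apply: (rV_norm_leP _ C0).1; exact: hC.
Qed.

Lemma mean_value_bound n (f df : R -> 'rV[R]_n) (T C : R) :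
  (forall s, `|s| < T -> is_derive s (1 : R) f (df s)) ->
  (forall s, `|s| < T -> `|df s| <= C) ->
  forall s t, `|s| < T -> `|t| < T -> `|f t - f s| <= C * `|t - s|.
Proof.
move=> hf hC.
have le s t : s <= t -> `|s| < T -> `|t| < T -> `|f t - f s| <= C * `|t - s|.
  move=> st sT tT; have inT r : r \in `[s, t] -> `|r| < T.
    by rewrite in_itv /=; move: sT tT; rewrite !ltr_norml; lra.
  rewrite (ger0_norm (_ : 0 <= t - s)) ?subr_ge0 //.
  by apply: mean_value_segment st _ _ => r /inT; [exact: hf|exact: hC].
move=> s t sT tT; have [st|/ltW ts] := leP s t; first exact: le.
by rewrite distrC (distrC t); exact: le.
Qed.

Lemma lipschitz_continuous (V W : normedModType R) (f : V -> W) (L : R) :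
  (forall x y, `|f x - f y| <= L * `|x - y|) -> continuous f.
Proof.
move=> h x; apply/cvgrPdist_lt => e e0; near=> y.
have L0 : 0 < `|L| + 1 by rewrite ltr_wpDl.
apply: le_lt_trans (h x y) _.
apply: (@le_lt_trans _ _ ((`|L| + 1) * `|x - y|)).
  by rewrite ler_wpM2r // ler_wpDr // ler_norm.
rewrite mulrC -ltr_pdivlMr //; near: y.
by apply: cvgr_dist_lt => //; rewrite divr_gt0.
Unshelve. all: by end_near. Qed.

(** Truncation to [-r, r], used to extend to the whole line functions of time
    known on an interval, and to the whole space vector fields known on a
    ball. *)
Definition clamp (r a : R) : R := Num.max (- r) (Num.min r a).

Lemma clamp_le r a : 0 <= r -> `|clamp r a| <= r.
Proof.
by move=> r0; rewrite ler_norml le_max ge_max ge_min !lexx /= andbT; lra.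
Qed.

Lemma clamp_id r a : `|a| <= r -> clamp r a = a.
Proof.
by rewrite ler_norml => /andP[ra ar]; rewrite /clamp (min_idPr ar) (max_idPr ra).
Qed.

Lemma clamp_lipschitz r a b : 0 <= r -> `|clamp r a - clamp r b| <= 1 * `|a - b|.
Proof.
move=> r0; rewrite mul1r /clamp; have := ler_norm (a - b); have := ler_norm (b - a).
rewrite (distrC b) => h1 h2; have h3 := normr_ge0 (a - b).
by case: (leP r a); case: (leP r b); rewrite ?le_max ?maxEle;
  repeat case: ifP; move=> *; rewrite ler_norml; apply/andP; split; lra.
Qed.

(** The lower bounds [a j - 2 D / 2 ^ j] increase and the upper bounds
    [a j + 2 D / 2 ^ j] decrease; the limit is the supremum of the former. *)
Lemma exists_geometric_limit (a : nat -> R) (D : R) :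
  (forall j, `|a j.+1 - a j| <= D / 2 ^+ j) ->
  exists l, forall j, `|a j - l| <= 2 * D / 2 ^+ j.
Proof.
move=> h.
have half j : 2 * D / 2 ^+ j.+1 = D / 2 ^+ j :> R.
  by rewrite exprS; field; rewrite expf_neq0 // pnatr_eq0.
have hs j : 2 * D / 2 ^+ j = D / 2 ^+ j + D / 2 ^+ j :> R by ring.
have D0 : 0 <= D by have := le_trans (normr_ge0 _) (h 0%N); rewrite expr0 divr1.
have Dj j : 0 <= 2 * D / 2 ^+ j by rewrite divr_ge0 ?mulr_ge0 ?exprn_ge0.
pose c j := a j - 2 * D / 2 ^+ j; pose d j := a j + 2 * D / 2 ^+ j.
have c_nd : nondecreasing_seq c.
  apply/nondecreasing_seqP => j; rewrite /c half hs.
  by have := h j; rewrite ler_norml => /andP[]; lra.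
have d_ni : nonincreasing_seq d.
  apply/nonincreasing_seqP => j; rewrite /d half hs.
  by have := h j; rewrite ler_norml => /andP[]; lra.
have cd i j : c i <= d j.
  apply: le_trans (c_nd _ _ (leq_maxl i j)) (le_trans _ (d_ni _ _ (leq_maxr i j))).
  by rewrite /c /d; have := Dj (maxn i j); lra.
exists (sup (range c)) => j.
have ub : has_sup (range c).
  by split; [exists (c 0%N), 0%N|exists (d 0%N) => _ [i _ <-]].
have l1 : c j <= sup (range c) by apply: sup_upper_bound => //; exists j.
have l2 : sup (range c) <= d j by apply: ge_sup => [|_ [i _ <-]] //; case: ub.
by move: l1 l2; rewrite ler_norml /c /d => l1 l2; apply/andP; split; lra.
Qed.

Lemma le_of_geometric (x y D : R) :
  (forall j, x <= y + D / 2 ^+ j) -> x <= y.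
Proof.
move=> h; apply/ler_addgt0Pr => e e0.
have : (fun j => D * (2^-1) ^+ j) @ \oo --> (0 : R).
  by apply: cvg_geometric; rewrite ger0_norm // invf_lt1 // ltr1n.
move=> /cvgrPdist_lt /(_ _ e0) [j _ /(_ j (leqnn _))].
rewrite /= sub0r normrN exprVn => he; apply: le_trans (h j) _.
by rewrite lerD2l; apply/ltW/(le_lt_trans (ler_norm _) he).
Qed.


(** The truncation of [t] gives a function continuous on the whole line, so
    that the construction can be iterated; it is a primitive of [f] on
    ]-1/2, 1/2[. The integral starts at -1 to make the differentiation
    theorem available on both sides of 0. *)
Definition primitive n (f : R -> 'rV[R]_n) (t : R) : 'rV[R]_n :=
  \row_j (parameterized_integral lebesgue_measure (-1) (clamp (2^-1) t) (fun s => f s 0 j)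
          - parameterized_integral lebesgue_measure (-1) 0 (fun s => f s 0 j)).

Lemma parameterized_integral_derive (f : R -> R) (t : R) : continuous f ->
  `|t| < 1 -> is_derive t (1 : R)
    (fun x => parameterized_integral lebesgue_measure (-1) x f) (f t).
Proof.
move=> cf; rewrite ltr_norml => /andP[t1 t2].
have fi : lebesgue_measure.-integrable `[-1, 1] (EFin \o f).
  apply: continuous_compact_integrable; first exact: segment_compact.
  exact: continuous_subspaceT.
have [d e] := continuous_FTC1_closed t2 fi t1 (cf t).
by split; [exact: d|rewrite -derive1E].
Qed.

Lemma primitive0 n (f : R -> 'rV[R]_n) : primitive f 0 = 0.
Proof.
by apply/rowP => j; rewrite !mxE clamp_id ?subrr // normr0 invr_ge0.
Qed.

Lemma primitive_continuous n (f : R -> 'rV[R]_n) : continuous f ->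
  continuous (primitive f).
Proof.
move=> cf; suff h : Ck_on 0 [set: R] (primitive f) by move=> t; exact: h.
apply/Ck_on_mxP => [|i j t _]; first exact: openT.
have cfj : continuous (fun s => f s 0 j).
  move=> s; apply: (@continuous_comp _ _ _ f (fun A : 'rV[R]_n => A 0 j)).
    exact: cf.
  exact: coord_continuous.
change (continuous_at t (fun s => primitive f s i j)).
under eq_fun do rewrite mxE.
apply: (@continuousB _ _ _ (fun s => parameterized_integral lebesgue_measure (-1)
  (clamp 2^-1 s) (fun r => f r 0 j)) (cst _)); last exact: cst_continuous.
have r0 : (0 : R) <= 2^-1 by rewrite invr_ge0.
apply: (@continuous_comp _ _ _ (clamp 2^-1) (fun s =>
  parameterized_integral lebesgue_measure (-1) s (fun r => f r 0 j))).
  exact: (lipschitz_continuous (fun x y => clamp_lipschitz x y r0)).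
have c1 : `|clamp 2^-1 t| < 1.
  by apply: le_lt_trans (clamp_le _ r0) _; rewrite invf_lt1 // ltr1n.
have [d _] := parameterized_integral_derive cfj c1.
exact/differentiable_continuous/derivable1_diffP.
Qed.

Lemma primitive_derive n (f : R -> 'rV[R]_n) t : continuous f -> `|t| < 2^-1 ->
  is_derive t (1 : R) (primitive f) (f t).
Proof.
move=> cf t2.
have cfj j : continuous (fun s => f s 0 j).
  move=> s; apply: (@continuous_comp _ _ _ f (fun A : 'rV[R]_n => A 0 j)).
    exact: cf.
  exact: coord_continuous.
have dj j : is_derive t (1 : R) (fun s => primitive f s 0 j) (f t 0 j).
  have t1 : `|t| < 1 by apply: lt_trans t2 _; rewrite invf_lt1 // ltr1n.
  have := is_deriveB (parameterized_integral_derive (cfj j) t1) (is_derive_cst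
    (parameterized_integral lebesgue_measure (-1) 0 (fun s => f s 0 j)) t 1).
  rewrite subr0; apply: near_eq_is_derive; near=> s.
  rewrite mxE clamp_id //; apply/ltW; near: s.
  by apply: cvgr_norm_lt t2; exact: cvg_id.
have d : derivable (primitive f) t 1.
  by apply/derivable_mxP => i j; rewrite ord1; have [] := dj j.
split=> //; rewrite derive_mx //; apply/rowP => j; rewrite mxE.
by have [] := dj j.
Unshelve. all: by end_near. Qed.

End Estimates.

(** * Ordinary differential equations *)

Section GlobalPicard.
Context {R : realType}.

Fixpoint picard n (F : 'rV[R]_n -> 'rV[R]_n) (x0 : 'rV[R]_n) (j : nat) (t : R) :
    'rV[R]_n :=
  if j is j'.+1 then x0 + primitive (fun s => F (picard F x0 j' s)) t else x0.

(** For [L T <= 1/2] an iteration halves the distance between two functions on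
    ]-T, T[, so the iterates converge geometrically. Their limit [v] is
    Lipschitz, and the primitive [x] of [F (v t)] is the limit of the same
    iterates, hence equal to [v]. *)
Lemma picard_lindeloef_global n (F : 'rV[R]_n -> 'rV[R]_n) (x0 : 'rV[R]_n) (K L : R) :
  0 < L -> (forall x, `|F x| <= K) -> (forall x y, `|F x - F y| <= L * `|x - y|) ->
  exists2 T : R, 0 < T & exists2 x : R -> 'rV[R]_n, x 0 = x0 &
    forall t, `|t| < T -> is_derive t (1 : R) x (F (x t)).
Proof.
move=> L0 FK FL; pose u := picard F x0.
have cF := lipschitz_continuous FL.
have cFu j : continuous (fun s => F (u j s)).
  elim: j => [|j IH] s; first exact: cst_continuous.
  apply: (@continuous_comp _ _ _ (u j.+1) F); last exact: cF.
  by apply: (@continuousD _ _ _ (cst x0)); [exact: cst_continuous|exact: primitive_continuous].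
pose T := Num.min 2^-1 (L^-1 / 2).
have T2 : T <= 2^-1 by rewrite ge_min lexx.
have LT : L * T <= 2^-1.
  apply: (@le_trans _ _ (L * (L^-1 / 2))).
    by rewrite ler_pM2l // ge_min lexx orbT.
  by rewrite mulrA divff ?mul1r // gt_eqF.
have T0 : 0 < T by rewrite lt_min; apply/andP; split; rewrite ?divr_gt0 ?invr_gt0.
have K0 : 0 <= K := le_trans (normr_ge0 _) (FK 0).
have uS j t : u j.+1 t = x0 + primitive (fun s => F (u j s)) t by [].
have u0 j : u j 0 = x0 by case: j => // j; rewrite uS primitive0 addr0.
have du j t : `|t| < T -> is_derive t (1 : R) (u j.+1) (F (u j t)).
  move=> tT; have tT2 : `|t| < 2^-1 by apply: lt_le_trans tT T2.
  have := is_deriveD (is_derive_cst x0 t (1 : R)) (primitive_derive (cFu j) tT2).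
  by rewrite add0r.
have u0t t : u 0%N t = x0 by [].
clearbody u.
have T_0 : `|0 : R| < T by rewrite normr0.
have contr (T' : R) (f g : R -> 'rV[R]_n) (df dg : R -> 'rV[R]_n) (D : R) :
    0 < T' -> T' <= T -> f 0 = g 0 ->
    (forall t, `|t| < T' -> is_derive t (1 : R) f (F (df t))) ->
    (forall t, `|t| < T' -> is_derive t (1 : R) g (F (dg t))) ->
    (forall t, `|t| < T' -> `|df t - dg t| <= D) ->
    forall t, `|t| < T' -> `|f t - g t| <= D / 2.
  move=> T'0 T'T fg0 hf hg hD t tT; have T'_0 : `|0 : R| < T' by rewrite normr0.
  have D0 : 0 <= D := le_trans (normr_ge0 _) (hD 0 T'_0).
  have := @mean_value_bound _ _ (fun s => f s - g s)
    (fun s => F (df s) - F (dg s)) T' (L * D) _ _ 0 t T'_0 tT.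
  rewrite fg0 subrr !subr0 => h; apply: le_trans (h _ _) _.
  - by move=> s sT; exact: is_deriveB (hf s sT) (hg s sT).
  - by move=> s sT; apply: le_trans (FL _ _) _; rewrite ler_pM2l //; exact: hD.
  rewrite -mulrA [D * _]mulrC mulrA [D / 2]mulrC ler_wpM2r //.
  by apply: le_trans LT; rewrite ler_pM2l //; exact: ltW (lt_le_trans tT T'T).
have hD j t : `|t| < T -> `|u j.+1 t - u j t| <= K / 2 ^+ j.
  elim: j t => [|j IH] t tT.
    rewrite expr0 divr1.
    have := mean_value_bound (du 0%N) (fun s _ => FK _) T_0 tT.
    rewrite u0 subr0 u0t => /le_trans; apply.
    rewrite ler_piMr //; apply: le_trans (ltW tT) (le_trans T2 _).
    by rewrite invf_le1 // ler1n.
  rewrite exprSr invfM mulrA.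
  by apply: (contr T) tT => //; rewrite !u0.
have lim_u t j : `|t| < T -> exists l, forall i, `|u i t 0 j - l| <= 2 * K / 2 ^+ i.
  move=> tT; apply: exists_geometric_limit => i.
  have := (rV_norm_leP _ _).1 (hD i t tT) j; rewrite !mxE; apply.
  by rewrite divr_ge0 // exprn_ge0.
pose v t := \row_j xget 0 [set l | forall i, `|u i t 0 j - l| <= 2 * K / 2 ^+ i].
have uv i t : `|t| < T -> `|u i t - v t| <= 2 * K / 2 ^+ i.
  move=> tT; apply/rV_norm_leP => [|j].
    by rewrite divr_ge0 ?exprn_ge0 // mulr_ge0.
  rewrite !mxE; case: xgetP => [l _ /(_ i)//|/=].
  by have [l hl /(_ l)] := lim_u t j tT.
pose T1 := T / 2; have T10 : 0 < T1 by rewrite divr_gt0.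
have T1T : T1 < T by rewrite ltr_pdivrMr // ltr_pMr // ltr1n.
(* [v] is only known to be Lipschitz on ]-T, T[, while [primitive] needs a
   function continuous on the line. *)
pose w t := v (clamp T1 t).
have cT t : `|clamp T1 t| < T by apply: le_lt_trans (clamp_le _ _) T1T; exact: ltW.
have v_lip s t : `|s| < T -> `|t| < T -> `|v s - v t| <= K * `|s - t|.
  move=> sT tT; apply: (@le_of_geometric _ _ _ (4 * K)) => i.
  have := mean_value_bound (du i) (fun s _ => FK _) tT sT.
  have := uv i.+1 s sT; have := uv i.+1 t tT.
  have -> : 2 * K / 2 ^+ i.+1 = K / 2 ^+ i.
    by rewrite exprS; field; rewrite expf_neq0 // pnatr_eq0.
  set P := K / _; move=> h1 h2 h3.
  have -> : v s - v t = (u i.+1 s - u i.+1 t) + ((u i.+1 t - v t) - (u i.+1 s - v s)).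
    by apply/rowP => j; rewrite !mxE; ring.
  apply: le_trans (ler_normD _ _) _; apply: lerD => //.
  apply: le_trans (ler_normB _ _) _.
  have P0 : 0 <= P := le_trans (normr_ge0 _) h1.
  by rewrite -mulrA -/P; lra.
have cw : continuous (fun s => F (w s)).
  have wl s t : `|w s - w t| <= K * `|s - t|.
    apply: le_trans (v_lip _ _ (cT s) (cT t)) _.
    rewrite ler_wpM2l // -[leRHS]mul1r; apply: clamp_lipschitz; exact: ltW.
  move=> s; apply: (@continuous_comp _ _ _ w F); last exact: cF.
  exact: lipschitz_continuous wl s.
pose x t := x0 + primitive (fun s => F (w s)) t.
have dx t : `|t| < 2^-1 -> is_derive t (1 : R) x (F (w t)).
  move=> tT; have := is_deriveD (is_derive_cst x0 t (1 : R)) (primitive_derive cw tT).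
  by rewrite add0r.
have x_0 : x 0 = x0 by rewrite /x primitive0 addr0.
clearbody x.
have xv t : `|t| < T1 -> x t = v t.
  move=> tT; apply/eqP; rewrite -subr_eq0 -normr_le0.
  apply: (@le_of_geometric _ _ _ (2 * K)) => i; rewrite add0r.
  have tT' := lt_trans tT T1T.
  have h1 := uv i.+1 t tT'; rewrite exprS invfM mulrA in h1.
  have h2 : `|u i.+1 t - x t| <= 2 * K / 2 ^+ i / 2.
    apply: (contr T1 (u i.+1) x (u i) w (2 * K / 2 ^+ i)) tT.
    - exact: T10.
    - exact: ltW.
    - exact: etrans (u0 _) (esym x_0).
    - by move=> s sT; apply: du; apply: lt_trans T1T.
    - move=> s sT; apply: dx; apply: lt_le_trans T2; exact: lt_trans T1T.
    - move=> s sT; rewrite /w clamp_id; last exact: ltW.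
      by apply: uv; exact: lt_trans T1T.
  have -> : x t - v t = (u i.+1 t - v t) - (u i.+1 t - x t).
    by apply/rowP => j; rewrite !mxE; ring.
  apply: le_trans (ler_normB _ _) _.
  rewrite [leRHS]splitr; apply: lerD => //; apply: le_trans h1 _.
  by rewrite -mulrA [2^-1 * _]mulrC mulrA.
exists T1 => //; exists x => // t tT.
have -> : x t = w t by rewrite /w clamp_id ?ltW // xv.
by apply: dx; apply: lt_le_trans T2; exact: lt_trans T1T.
Qed.

End GlobalPicard.

Section LocalODE.
Context {R : realType}.

(** On a ball where the partial derivatives of [F] are bounded, the mean value
    inequality applies along segments, balls being convex. *)
Lemma locally_lipschitz n p (U : set 'rV[R]_n) (F : 'rV[R]_n -> 'rV[R]_p)
    (x0 : 'rV[R]_n) : open U -> U x0 -> Ck_on 1 U F ->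
  exists2 r : R, 0 < r & exists2 L : R, 0 < L &
    (forall x, `|x - x0| < r -> U x) /\
    (forall x y, `|x - x0| < r -> `|y - x0| < r -> `|F x - F y| <= L * `|x - y|).
Proof.
move=> oU Ux0 hF.
pose C i := `|'D_(delta_mx 0 i) F x0| + 1.
have : \forall x \near x0, U x /\ forall i, `|'D_(delta_mx 0 i) F x| <= C i.
  near=> x; split; first by near: x; exact: open_nbhs_nbhs.
  near: x; apply: filter_forall => i; near=> x; apply/ltW; near: x.
  apply: (@cvgr_norm_lt _ _ _ _ _ _ ('D_(delta_mx 0 i) F x0)).
    exact: hF.2.
  by rewrite /C ltrDl.
move=> /nbhs_ballP[r /= r0 hr].
have {}hr x : `|x - x0| < r -> U x /\ forall i, `|'D_(delta_mx 0 i) F x| <= C i.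
  by move=> xr; apply: hr; rewrite -ball_normE /= distrC.
have L0 : 0 < 1 + \sum_i C i.
  by rewrite ltr_wpDr // sumr_ge0 // => i _; rewrite addr_ge0.
exists r => //; exists (1 + \sum_i C i) => //; split=> [x /hr[]//|x y xr yr].
pose f (s : R) := F (y + s *: (x - y)).
have ins (s : R) : s \in `[0, 1] -> `|y + s *: (x - y) - x0| < r.
  rewrite in_itv /= => /andP[s0 s1].
  have -> : y + s *: (x - y) - x0 = s *: (x - x0) + (1 - s) *: (y - x0).
    by apply/rowP => j; rewrite !mxE; ring.
  apply: le_lt_trans (ler_normD _ _) _; rewrite !normrZ !ger0_norm ?subr_ge0 //.
  move: s0; rewrite le_eqVlt => /orP[/eqP <-|s0].
    by rewrite mul0r add0r subr0 mul1r.
  have -> : r = s * r + (1 - s) * r by ring.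
  by apply: ltr_leD; rewrite ?ltr_pM2l // ler_wpM2l ?subr_ge0 // ltW.
have df (s : R) : s \in `[0, 1] ->
    is_derive s (1 : R) f ('D_(x - y) F (y + s *: (x - y))).
  by move=> /ins /hr [Us _]; apply: is_derive_line; exact: hF.1.
have := @mean_value_segment _ _ f (fun s => 'D_(x - y) F (y + s *: (x - y))) 0 1
  ((1 + \sum_i C i) * `|x - y|) ler01 df.
rewrite /f scale0r addr0 scale1r [y + (x - y)]addrC subrK subr0 mulr1; apply.
move=> s /ins /hr [Us hC].
rewrite deriveE; last exact: hF.1.
rewrite [X in 'd _ _ X](row_sum_delta (x - y)) linear_sum.
apply: le_trans (ler_norm_sum _ _ _) _.
rewrite mulrDl mul1r mulr_suml; apply: (@le_trans _ _ (\sum_i C i * `|x - y|)); last first.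
  by rewrite lerDr.
apply: ler_sum => i _; rewrite linearZ normrZ mulrC -deriveE; last exact: hF.1.
apply: ler_pM => //; have := (rV_norm_leP (x - y) (normr_ge0 (x - y))).1; exact.
Unshelve. all: by end_near. Qed.

Definition clamp_rV n (x0 : 'rV[R]_n) (r : R) (x : 'rV[R]_n) : 'rV[R]_n :=
  x0 + \row_j clamp r ((x - x0) 0 j).

Lemma clamp_rV_le n (x0 : 'rV[R]_n) r x : 0 <= r -> `|clamp_rV x0 r x - x0| <= r.
Proof.
move=> r0; rewrite /clamp_rV [x0 + _]addrC addrK; apply/rV_norm_leP => // j.
by rewrite mxE; exact: clamp_le.
Qed.

Lemma clamp_rV_id n (x0 : 'rV[R]_n) r x : 0 <= r -> `|x - x0| <= r ->
  clamp_rV x0 r x = x.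
Proof.
move=> r0 /(rV_norm_leP _ r0) h; apply/rowP => j; rewrite mxE [X in _ + X]mxE clamp_id //.
by rewrite !mxE; ring.
Qed.

Lemma clamp_rV_lipschitz n (x0 : 'rV[R]_n) r x y : 0 <= r ->
  `|clamp_rV x0 r x - clamp_rV x0 r y| <= `|x - y|.
Proof.
move=> r0; apply/rV_norm_leP => // j.
have -> : (clamp_rV x0 r x - clamp_rV x0 r y) 0 j =
  clamp r ((x - x0) 0 j) - clamp r ((y - x0) 0 j) by rewrite !mxE; ring.
apply: le_trans (clamp_lipschitz _ _ r0) _; rewrite mul1r.
have -> : (x - x0) 0 j - (y - x0) 0 j = (x - y) 0 j by rewrite !mxE; ring.
exact: (rV_norm_leP _ _).1.
Qed.

(** Composed with the truncation to a small ball, the field becomes bounded and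
    Lipschitz. A solution for the truncated field moves at bounded speed, so
    for a short time it stays in the ball, where the two fields agree. *)
Lemma picard_lindeloef n (U : set 'rV[R]_n) (F : 'rV[R]_n -> 'rV[R]_n) (x0 : 'rV[R]_n) :
  open U -> U x0 -> Ck_on 1 U F ->
  exists2 T : R, 0 < T & exists2 x : R -> 'rV[R]_n, x 0 = x0 &
    forall t, `|t| < T -> U (x t) /\ is_derive t (1 : R) x (F (x t)).
Proof.
move=> oU Ux0 hF; have [r r0 [L L0 [hU hL]]] := locally_lipschitz oU Ux0 hF.
pose q := r / 2; have q0 : 0 < q by rewrite divr_gt0.
have qr : q < r by rewrite ltr_pdivrMr // ltr_pMr // ltr1n.
have cr y : `|clamp_rV x0 q y - x0| < r.
  by apply: le_lt_trans (clamp_rV_le _ _ (ltW q0)) qr.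
pose G y := F (clamp_rV x0 q y).
have x0r : `|x0 - x0| < r by rewrite subrr normr0.
have GL y z : `|G y - G z| <= L * `|y - z|.
  apply: le_trans (hL _ _ (cr y) (cr z)) _.
  by rewrite ler_pM2l //; exact: clamp_rV_lipschitz (ltW q0).
pose K := `|F x0| + L * r.
have K0 : 0 < K by rewrite ltr_wpDl // mulr_gt0.
have GK y : `|G y| <= K.
  rewrite -[G y](subrK (F x0)) addrC; apply: le_trans (ler_normD _ _) _.
  rewrite lerD2l; apply: le_trans (hL _ _ (cr y) x0r) _.
  by rewrite ler_pM2l // ltW.
have [T T0 [x x_0 dx]] := picard_lindeloef_global x0 L0 GK GL.
exists (Num.min T (q / K)); first by rewrite lt_min T0 divr_gt0.
exists x => // t; rewrite lt_min => /andP[tT tq].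
have T_0 : `|0 : R| < T by rewrite normr0.
have xq : `|x t - x0| <= q.
  have := mean_value_bound dx (fun s _ => GK _) T_0 tT.
  rewrite x_0 subr0 => /le_trans; apply.
  by rewrite mulrC -ler_pdivlMr // ltW.
split; first by apply: hU; apply: le_lt_trans qr.
by have := dx t tT; rewrite /G clamp_rV_id // ltW.
Qed.

(** Let [c] maximize [|w|] on [-e, e] with [L e <= 1/2]. The mean value
    inequality on [0, c] gives [|w c| <= |w c| / 2]. *)
Lemma ode_vanish n (w dw : R -> 'rV[R]_n) (T L : R) : 0 < T -> 0 < L ->
  w 0 = 0 -> (forall t, `|t| < T -> is_derive t (1 : R) w (dw t)) ->
  (forall t, `|t| < T -> `|dw t| <= L * `|w t|) ->
  exists2 e : R, 0 < e & forall t, `|t| < e -> w t = 0.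
Proof.
move=> T0 L0 w0 hw hL; pose e := Num.min (T / 2) (L^-1 / 2).
have e0 : 0 < e by rewrite lt_min; apply/andP; split; rewrite ?divr_gt0 ?invr_gt0.
have eT : e < T.
  by rewrite gt_min ltr_pdivrMr // ltr_pMr // ltr1n.
have Le : L * e <= 2^-1.
  apply: (@le_trans _ _ (L * (L^-1 / 2))).
    by rewrite ler_pM2l // ge_min lexx orbT.
  by rewrite mulrA divff ?mul1r // gt_eqF.
have inT t : t \in `[- e, e] -> `|t| < T.
  by rewrite in_itv /= -ler_norml => /le_lt_trans; apply.
have cw : {within `[- e, e], continuous (fun t => `|w t|)}.
  apply/continuous_in_subspaceT => t /[1!inE] /inT tT.
  apply: (@continuous_comp _ _ _ w (fun z => `|z|)); last exact: norm_continuous.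
  by apply/differentiable_continuous/derivable1_diffP; have [] := hw t tT.
have [|c ce hc] := EVT_max _ cw; first by rewrite ge0_cp // ltW.
have T_0 : `|0 : R| < T by rewrite normr0.
have bound t : t \in `[- e, e] -> `|w t| <= 2^-1 * `|w c|.
  move=> te; have te' : `|t| <= e by move: te; rewrite in_itv /= -ler_norml.
  have : `|w t - w 0| <= L * `|w c| * `|t - 0|.
    have [t0|t0] := leP 0 t.
      rewrite (ger0_norm (_ : 0 <= t - 0)) ?subr_ge0 //.
      have ins s : s \in `[0, t] -> s \in `[- e, e].
        by move: te; rewrite !in_itv /=; lra.
      apply: (mean_value_segment t0) => s /ins se.
        by apply: hw; exact: inT.
      by apply: le_trans (hL _ (inT _ se)) _; rewrite ler_pM2l // hc.
    have t0' : 0 <= 0 - t by rewrite subr_ge0 ltW.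
    rewrite distrC (distrC t) (ger0_norm t0').
    have ins s : s \in `[t, 0] -> s \in `[- e, e].
      by move: te; rewrite !in_itv /=; lra.
    apply: (mean_value_segment (ltW t0)) => s /ins se.
      by apply: hw; exact: inT.
    by apply: le_trans (hL _ (inT _ se)) _; rewrite ler_pM2l // hc.
  rewrite w0 !subr0 => /le_trans; apply.
  rewrite mulrAC ler_wpM2r //; apply: le_trans Le.
  by rewrite ler_pM2l.
have wc0 : `|w c| = 0.
  by apply/eqP; rewrite eq_le normr_ge0 andbT; have := bound c ce; lra.
exists e => // t te; apply/eqP; rewrite -normr_le0 -wc0; apply: hc.
by rewrite in_itv /= -ler_norml ltW.
Qed.

End LocalODE.

(** * Smooth solutions of second-order equations *)

Section SecondOrder.
Context {R : realType}.

Lemma norm_lt_itv (T : R) : [set t : R | `|t| < T] = `]- T, T[%classic.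
Proof. by apply/seteqP; split=> t /=; rewrite in_itv /= ltr_norml. Qed.

Lemma open_norm_lt (T : R) : open [set t : R | `|t| < T].
Proof. by rewrite norm_lt_itv; exact: itv_open. Qed.

Lemma derive_scale_dir (V W : normedModType R) (f : V -> W) x v (a : R) :
  differentiable f x -> 'D_(a *: v) f x = a *: 'D_v f x.
Proof. by move=> df; rewrite !deriveE // linearZ. Qed.

(** A solution of class C^k makes [F (x t)], which is its derivative, of class
    C^k as well. *)
Lemma ode_smooth n (I : set R) (U : set 'rV[R]_n) (F : 'rV[R]_n -> 'rV[R]_n)
    (x : R -> 'rV[R]_n) : open I -> open U -> smooth_on U F ->
  (forall t, I t -> U (x t) /\ is_derive t (1 : R) x (F (x t))) -> smooth_on I x.
Proof.
move=> oI oU sF hx.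
have dx t : I t -> differentiable x t.
  by move=> /hx [_ [d _]]; exact/derivable1_diffP.
elim=> [t It|k IH]; first exact/differentiable_continuous/dx.
split=> // v; apply: (@Ck_on_eq _ _ _ _ _ (fun t => v *: F (x t))) => //.
  move=> t It; have [_ [_ e]] := hx t It.
  by rewrite -e -(@derive_scale_dir R _ x t 1 v (dx t It)) [v *: 1]mulr1.
apply: (@Ck_on_linear_comp _ _ _ _ _ _ (fun t => F (x t)) ( *:%R v)) => //.
- by move=> a y z; rewrite scalerDr !scalerA mulrC.
- exact: scaler_continuous.
by apply: (Ck_on_comp oI oU _ IH (sF k)) => t /hx[].
Qed.

(** The first-order system is solved by the pair [row_mx x x'], on the open
    set where the position lies in [U]. *)
Lemma second_order_ode n (U : set 'rV[R]_n) (G : 'rV[R]_n -> 'rV[R]_n -> 'rV[R]_n)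
    (x0 v0 : 'rV[R]_n) : open U -> U x0 ->
  smooth_on [set s : 'rV[R]_(n + n) | U (lsubmx s)] (fun s => G (lsubmx s) (rsubmx s)) ->
  exists2 T : R, 0 < T & exists x : R -> 'rV[R]_n,
    [/\ x 0 = x0, derive1 x 0 = v0, smooth_on [set t | `|t| < T] x &
    forall t, `|t| < T -> U (x t) /\
      derive1 (derive1 x) t = G (x t) (derive1 x t)].
Proof.
move=> oU Ux0 sG.
pose W := [set s : 'rV[R]_(n + n) | U (lsubmx s)].
have oW : open W.
  by apply: open_comp => // s _; exact: continuous_lsubmx.
pose F (s : 'rV[R]_(n + n)) : 'rV[R]_(n + n) := row_mx (rsubmx s) (G (lsubmx s) (rsubmx s)).
have sF : smooth_on W F.
  move=> k; apply/Ck_on_mxP => // i j.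
  rewrite ord1; case: (split_ordP j) => l ->.
    under eq_fun do rewrite row_mxEl mxE.
    apply: Ck_on_linear; last exact: coord_continuous.
    by move=> a y z; rewrite !mxE.
  under eq_fun do rewrite row_mxEr.
  exact: ((Ck_on_mxP _ _ oW).1 (sG k)).
have W0 : W (row_mx x0 v0) by rewrite /W /= row_mxKl.
have [T T0 [s s0 hs]] := picard_lindeloef oW W0 (sF 1%N).
have oI := @open_norm_lt T.
have ss := ode_smooth oI oW sF hs.
exists T => //; exists (fun t => lsubmx (s t)).
have dl t : `|t| < T -> derive1 (fun t => lsubmx (s t)) t = rsubmx (s t).
  move=> tT; rewrite derive1E; have [_ [d e]] := hs t tT.
  rewrite derive_mx; last first.
    apply/derivable_mxP => i j; under eq_fun do rewrite mxE.
    exact: (derivable_mxP _ _ _).1.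
  apply/matrixP => i j; rewrite mxE; under eq_fun do rewrite mxE.
  move/matrixP : e => /(_ i (lshift n j)); rewrite derive_mx // mxE => ->.
  by rewrite /F ord1 row_mxEl.
have dr t : `|t| < T -> derive1 (fun t => rsubmx (s t)) t = G (lsubmx (s t)) (rsubmx (s t)).
  move=> tT; rewrite derive1E; have [_ [d e]] := hs t tT.
  rewrite derive_mx; last first.
    apply/derivable_mxP => i j; under eq_fun do rewrite mxE.
    exact: (derivable_mxP _ _ _).1.
  apply/matrixP => i j; rewrite mxE; under eq_fun do rewrite mxE.
  move/matrixP : e => /(_ i (rshift n j)); rewrite derive_mx // mxE => ->.
  by rewrite /F ord1 row_mxEr.
split=> [|||t tT].
- by rewrite s0 row_mxKl.
- by rewrite dl ?normr0 // s0 row_mxKr.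
- move=> k; apply/Ck_on_mxP => // i j; under [X in Ck_on _ _ X]eq_fun do rewrite mxE.
  exact: ((Ck_on_mxP _ _ oI).1 (ss k)).
split; first exact: (hs t tT).1.
rewrite dl // -dr //; apply: etrans (derive1E _ _) _; apply: etrans _ (esym (derive1E _ _)).
apply: near_eq_derive; near=> r; apply: dl; near: r; exact: open_nbhs_nbhs.
Unshelve. all: by end_near. Qed.

End SecondOrder.

(** * Christoffel symbols and quadratic forms *)

Section Christoffel.
Context {R : realType}.

Lemma derive_sum_dir (V W : normedModType R) (f : V -> W) x (n : nat) (a : 'I_n -> R) (v : 'I_n -> V) :
  differentiable f x ->
  'D_(\sum_i a i *: v i) f x = \sum_i a i *: 'D_(v i) f x.
Proof.
move=> df; rewrite deriveE // linear_sum; apply: eq_bigr => i _.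
by rewrite linearZ deriveE.
Qed.

(** Only the diagonal [u = v] is needed for accelerations of curves; there the
    first two terms of a Christoffel symbol contribute equally. *)
Lemma christoffel_applyE n (G : 'rV[R]_n -> 'M[R]_n) x u : differentiable G x ->
  christoffel_apply G x u u = 2^-1 *: ((u *m 'D_u G x + u *m 'D_u G x
    - \row_h bform ('D_(delta_mx 0 h) G x) u u) *m invmx (G x)).
Proof.
move=> dG; have pE i a b : partial i (fun y => G y a b) x = ('D_(delta_mx 0 i) G x) a b.
  have /matrixP/(_ a b) := derive_mx (diff_derivable dG : derivable G x (delta_mx 0 i)).
  by rewrite mxE => ->.
have DE : 'D_u G x = \sum_i u 0 i *: 'D_(delta_mx 0 i) G x.
  by rewrite [X in 'D_X _ _](row_sum_delta u) derive_sum_dir.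
pose A i j h := ('D_(delta_mx 0 i) G x) j h.
pose X i j h := A i j h + A j i h - A h i j.
have claim1 h : (u *m 'D_u G x) 0 h = \sum_i \sum_j u 0 i * u 0 j * A i j h.
  rewrite exchange_big mxE; apply: eq_bigr => j _; rewrite DE summxE mulr_sumr.
  by apply: eq_bigr => i _; rewrite mxE mulrA [u 0 j * _]mulrC.
have claim2 h : (u *m 'D_u G x) 0 h = \sum_i \sum_j u 0 i * u 0 j * A j i h.
  rewrite mxE; apply: eq_bigr => j _; rewrite DE summxE mulr_sumr.
  by apply: eq_bigr => i _; rewrite mxE mulrA.
have claim3 h : bform ('D_(delta_mx 0 h) G x) u u = \sum_i \sum_j u 0 i * u 0 j * A h i j.
  rewrite /bform exchange_big mxE; apply: eq_bigr => j _; rewrite mxE mulr_suml.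
  by apply: eq_bigr => i _; rewrite mxE mulrAC.
have xi h : (u *m 'D_u G x + u *m 'D_u G x
    - \row_h bform ('D_(delta_mx 0 h) G x) u u) 0 h = \sum_i \sum_j u 0 i * u 0 j * X i j h.
  have -> : (u *m 'D_u G x + u *m 'D_u G x - \row_h bform ('D_(delta_mx 0 h) G x) u u) 0 h
      = (u *m 'D_u G x) 0 h + (u *m 'D_u G x) 0 h - bform ('D_(delta_mx 0 h) G x) u u.
    by rewrite [LHS]mxE [X in X + _]mxE [X in _ + X]mxE [X in _ - X]mxE.
  rewrite [X in X + _ - _]claim1 claim2 claim3 -big_split -sumrB; apply: eq_bigr => i _ /=.
  rewrite -big_split -sumrB; apply: eq_bigr => j _ /=.
  by rewrite -mulrDr -mulrBr.
apply/rowP => l; rewrite [RHS]mxE [X in _ * X]mxE [LHS]mxE.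
under [X in _ * X]eq_bigr do rewrite xi mulr_suml.
rewrite [in RHS]exchange_big mulr_sumr; apply: eq_bigr => i _ /=.
under [X in _ * X]eq_bigr do rewrite mulr_suml.
rewrite [in RHS]exchange_big mulr_sumr; apply: eq_bigr => j _ /=.
rewrite /christoffel mulrCA; congr (_ * _); rewrite mulr_sumr.
by apply: eq_bigr => h _; rewrite !pE mulrA.
Qed.

Lemma bformDl n (B : 'M[R]_n) u v w : bform B (u + v) w = bform B u w + bform B v w.
Proof. by rewrite /bform !mulmxDl mxE. Qed.

Lemma bformNl n (B : 'M[R]_n) u w : bform B (- u) w = - bform B u w.
Proof. by rewrite /bform !mulNmx mxE. Qed.

Lemma bformBl n (B : 'M[R]_n) u v w : bform B (u - v) w = bform B u w - bform B v w.
Proof. by rewrite bformDl bformNl. Qed.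

Lemma bform_sym n (B : 'M[R]_n) u v : B^T = B -> bform B u v = bform B v u.
Proof.
move=> sB; have E : (u *m B *m v^T)^T = v *m B *m u^T.
  by rewrite !trmx_mul trmxK sB mulmxA.
by rewrite /bform -E [RHS]mxE.
Qed.

Lemma bform_derive n (G : 'rV[R]_n -> 'M[R]_n) x u v w : differentiable G x ->
  bform ('D_w G x) u v = \sum_h bform ('D_(delta_mx 0 h) G x) u v * w 0 h.
Proof.
move=> dG; rewrite [X in 'D_X _ _](row_sum_delta w) derive_sum_dir //.
rewrite /bform mulmx_sumr mulmx_suml summxE; apply: eq_bigr => h _.
by rewrite -scalemxAr -scalemxAl mxE mulrC.
Qed.

(** Lowering the index removes the inverse of the metric and leaves the
    Christoffel symbols of the first kind. *)
Lemma bform_christoffel n (G : 'rV[R]_n -> 'M[R]_n) x u w :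
  differentiable G x -> G x \in unitmx ->
  bform (G x) (christoffel_apply G x u u) w =
  bform ('D_u G x) u w - 2^-1 * bform ('D_w G x) u u.
Proof.
move=> dG uG; rewrite christoffel_applyE //.
set A := u *m _; set rho := \row_h _.
have E1 : bform (G x) (2^-1 *: ((A + A - rho) *m invmx (G x))) w =
    2^-1 * ((A + A - rho) *m w^T) 0 0.
  by rewrite /bform -scalemxAl mulmxKV // -scalemxAl mxE.
have E2 : ((A + A - rho) *m w^T) 0 0 =
    (A *m w^T) 0 0 + (A *m w^T) 0 0 - (rho *m w^T) 0 0.
  by rewrite mulmxBl mulmxDl [LHS]mxE [X in X + _]mxE [X in _ + X]mxE.
have E3 : (rho *m w^T) 0 0 = bform ('D_w G x) u u.
  by rewrite bform_derive // mxE; apply: eq_bigr => h _; rewrite !mxE.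
by rewrite E1 E2 E3 [bform _ u w]/bform -/A; field.
Qed.

End Christoffel.

(** * The Gauss formula in coordinates *)

Section CoordinateIsometries.
Context {R : realType}.

(** The covariant Hessian of [phi] on the diagonal, for the Levi-Civita
    connections of the Gram matrices [G1] and [G2]. *)
Definition sff_map n p (phi : 'rV[R]_n -> 'rV[R]_p) (G1 : 'rV[R]_n -> 'M[R]_n)
    (G2 : 'rV[R]_p -> 'M[R]_p) (y u : 'rV[R]_n) : 'rV[R]_p :=
  u *m 'D_u (fun z => 'J phi z) y
  + christoffel_apply G2 (phi y) (u *m 'J phi y) (u *m 'J phi y)
  - christoffel_apply G1 y u u *m 'J phi y.

Lemma bform_pull n p (B : 'M[R]_p) (J J' : 'M[R]_(n, p)) u v :
  bform (J *m B *m J'^T) u v = bform B (u *m J) (v *m J').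
Proof. by rewrite /bform trmx_mul !mulmxA. Qed.

Lemma bformD n (A B : 'M[R]_n) u v : bform (A + B) u v = bform A u v + bform B u v.
Proof. by rewrite /bform mulmxDr mulmxDl [LHS]mxE. Qed.

(** Koszul's formula expresses the product of the acceleration with [w] by
    derivatives of the metric. Differentiating [G1 = J G2 J^T] produces the
    terms of Koszul's formula for [G2] and terms with second derivatives of
    [phi]; by symmetry of the latter, all but one cancel. *)
Lemma sff_map_orthogonal n p (U : set 'rV[R]_n) (phi : 'rV[R]_n -> 'rV[R]_p)
    (G1 : 'rV[R]_n -> 'M[R]_n) (G2 : 'rV[R]_p -> 'M[R]_p) y u w :
  open U -> U y -> Ck_on 2 U phi ->
  (forall z, U z -> G1 z = 'J phi z *m G2 (phi z) *m ('J phi z)^T) ->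
  differentiable G1 y -> differentiable G2 (phi y) -> (G2 (phi y))^T = G2 (phi y) ->
  G1 y \in unitmx -> G2 (phi y) \in unitmx ->
  bform (G2 (phi y)) (sff_map phi G1 G2 y u) (w *m 'J phi y) = 0.
Proof.
move=> oU Uy hphi iso dG1 dG2 sG2 uG1 uG2.
pose J z := 'J phi z; set Q := G2 (phi y).
have dphi : differentiable phi y by exact: hphi.1.
have dJ : differentiable J y by apply: (Ck_on_jacobian oU hphi).1.
have dG : differentiable (fun z => G2 (phi z)) y by exact: differentiable_comp.
have DG v : 'D_v G1 y = 'D_v J y *m Q *m (J y)^T
    + J y *m 'D_(v *m J y) G2 (phi y) *m (J y)^T + J y *m Q *m ('D_v J y)^T.
  have nG : \forall z \near y, (J z *m G2 (phi z)) *m (J z)^T = G1 z.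
    by near=> z; rewrite iso //; near: z; exact: open_nbhs_nbhs.
  have DJ : is_derive y v J ('D_v J y) by apply/derivableP/diff_derivable.
  have D2 : is_derive y v (fun z => G2 (phi z)) ('D_(v *m J y) G2 (phi y)).
    by rewrite -(deriveEjacobian v dphi); exact: is_derive_comp.
  have [_ D] := is_derive_mulmx (is_derive_mulmx DJ D2) (is_derive_trmx DJ).
  apply: etrans (esym (near_eq_derive v nG)) _; apply: etrans D _.
  by rewrite mulmxDl.
have := bform_christoffel u w dG1 uG1.
have := bform_christoffel (u *m J y) (w *m J y) dG2 uG2.
have := jacobian_schwarz w u oU Uy hphi.
have := DG u; have := DG w; rewrite -/J -/Q (iso y Uy) -/(J y) -/Q.
rewrite /sff_map -/(J y) -/J.
move: sG2; rewrite -/Q.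
move: ('D_u G1 y) ('D_w G1 y) ('D_u J y) ('D_w J y) => D1 D2 D3 D4.
move: ('D_(u *m J y) G2 (phi y)) ('D_(w *m J y) G2 (phi y)) => D5 D6.
move: (christoffel_apply G1 y u u) (christoffel_apply G2 (phi y) _ _) => c1 c2.
move: (Q) (J y) => P Jy sQ -> -> Ew; rewrite !bform_pull => E2 E3.
rewrite bformBl bformDl E2 E3 !bformD !bform_pull Ew.
rewrite (bform_sym (u *m Jy) (u *m D4) sQ).
by field.
Unshelve. all: by end_near. Qed.

Definition coord_acc n (G : 'rV[R]_n -> 'M[R]_n) (x : R -> 'rV[R]_n) (t : R) : 'rV[R]_n :=
  derive1 (derive1 x) t + christoffel_apply G (x t) (derive1 x t) (derive1 x t).

Lemma is_derive_curve_comp n p q (x : R -> 'rV[R]_n) (f : 'rV[R]_n -> 'M[R]_(p, q)) t :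
  differentiable x t -> differentiable f (x t) ->
  is_derive t (1 : R) (fun s => f (x s)) ('D_(derive1 x t) f (x t)).
Proof. by move=> dx df; rewrite derive1E; exact: is_derive_comp. Qed.

Lemma velocity_comp n p (x : R -> 'rV[R]_n) (phi : 'rV[R]_n -> 'rV[R]_p)
    (z : R -> 'rV[R]_p) t :
  differentiable x t -> differentiable phi (x t) ->
  (\forall s \near t, z s = phi (x s)) -> derive1 z t = derive1 x t *m 'J phi (x t).
Proof.
move=> dx df zE; apply: etrans (derive1E _ _) _.
apply: etrans (near_eq_derive (1 : R) zE) _.
have [_ e] := is_derive_curve_comp dx df; apply: etrans e _.
exact: deriveEjacobian.
Qed.

(** Differentiating [z' = x' J(x)] once more: the derivative of the Jacobian
    along [x'] is the Hessian term of [sff_map]. *)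
Lemma coord_acc_comp n p (I : set R) (U : set 'rV[R]_n) (phi : 'rV[R]_n -> 'rV[R]_p)
    (G1 : 'rV[R]_n -> 'M[R]_n) (G2 : 'rV[R]_p -> 'M[R]_p)
    (x : R -> 'rV[R]_n) (z : R -> 'rV[R]_p) t :
  open I -> I t -> Ck_on 2 I x -> open U -> Ck_on 2 U phi ->
  (forall s, I s -> U (x s)) -> (\forall s \near t, z s = phi (x s)) ->
  coord_acc G2 z t =
  coord_acc G1 x t *m 'J phi (x t) + sff_map phi G1 G2 (x t) (derive1 x t).
Proof.
move=> oI It hx oU hphi xU zE.
have dx s : I s -> differentiable x s by move=> Is; exact: hx.1.
have dphi s : I s -> differentiable phi (x s) by move=> Is; apply: hphi.1; exact: xU.
have dx' : differentiable (derive1 x) t.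
  have -> : derive1 x = (fun s => 'D_1 x s) by apply/funext => s; rewrite derive1E.
  exact: (hx.2 1).1.
have zt := nbhs_singleton zE.
have vE s : I s -> (\forall r \near s, z r = phi (x r)) ->
    derive1 z s = derive1 x s *m 'J phi (x s).
  by move=> Is; apply: velocity_comp; [exact: dx|exact: dphi].
have vnear : \forall s \near t, derive1 z s = derive1 x s *m 'J phi (x s).
  near=> s; apply: vE; first by near: s; exact: open_nbhs_nbhs.
  by near: s; exact: nbhs_interior.
have dJ : differentiable (fun y => 'J phi y) (x t).
  by apply: (Ck_on_jacobian oU hphi).1; exact: xU.
have DJ := is_derive_curve_comp (dx t It) dJ.
have Dx : is_derive t (1 : R) (derive1 x) (derive1 (derive1 x) t).
  by split; [exact/derivable1_diffP|rewrite derive1E].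
have [_ D] := is_derive_mulmx Dx DJ.
have Az : derive1 (derive1 z) t = derive1 (derive1 x) t *m 'J phi (x t)
    + derive1 x t *m 'D_(derive1 x t) (fun y => 'J phi y) (x t).
  apply: etrans (derive1E _ _) _; apply: etrans D.
  exact: near_eq_derive.
rewrite /coord_acc /sff_map Az (vE t It zE) zt mulmxDl.
set a := _ *m _; set b := _ *m _; set c := christoffel_apply _ _ _ _.
set d := _ *m _.
by rewrite -(addrA a d) -(addrA a b); congr (a + _); rewrite [RHS]addrC subrK.
Unshelve. all: by end_near. Qed.

End CoordinateIsometries.

(** * Smooth maps between manifolds in charts *)

Section MapsInCharts.
Context {R : realType}.

Definition coord_rep (M1 M2 : topologicalType) n1 n2 (f : M1 -> M2)
    (c : @chart R M1 n1) (d : @chart R M2 n2) : 'rV[R]_n1 -> 'rV[R]_n2 :=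
  d \o f \o cinv c.

Definition rep_dom (M1 M2 : topologicalType) n1 n2 (f : M1 -> M2)
    (c : @chart R M1 n1) (d : @chart R M2 n2) : set 'rV[R]_n1 :=
  c @` (cdom c `&` f @^-1` cdom d).

(** Changes of charts are the case [f = id]; they are handled by the same
    statements as the inclusion of a submanifold. *)
Definition smooth_map (M1 M2 : topologicalType) n1 n2
    (S1 : @smooth_structure R M1 n1) (S2 : @smooth_structure R M2 n2)
    (f : M1 -> M2) : Prop :=
  continuous f /\ forall c d, atlas S1 c -> atlas S2 d ->
    smooth_on (rep_dom f c d) (coord_rep f c d).

Lemma near_open (T : topologicalType) (A : set T) x : open A -> A x ->
  \forall y \near x, A y.
Proof. by move=> oA Ax; exact: (open_nbhs_nbhs (conj oA Ax)). Qed.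

Lemma open_cimg (M : topologicalType) n (c : @chart R M n) : open (cimg c).
Proof. exact: cimg_open. Qed.

Lemma cimgP (M : topologicalType) n (c : @chart R M n) x : cimg c x ->
  cdom c (cinv c x) /\ c (cinv c x) = x.
Proof. by move=> [p cp <-]; rewrite cmapK. Qed.

Lemma cdom_cimg (M : topologicalType) n (c : @chart R M n) p : cdom c p -> cimg c (c p).
Proof. by exists p. Qed.

Lemma rep_domP (M1 M2 : topologicalType) n1 n2 (f : M1 -> M2)
    (c : @chart R M1 n1) (d : @chart R M2 n2) x :
  rep_dom f c d x <-> cimg c x /\ cdom d (f (cinv c x)).
Proof.
split=> [[p [cp dp] <-]|[/cimgP[cx xE] dx]].
  by rewrite cmapK //; split=> //; exact: cdom_cimg.
by exists (cinv c x).
Qed.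

Lemma rep_dom_cmap (M1 M2 : topologicalType) n1 n2 (f : M1 -> M2)
    (c : @chart R M1 n1) (d : @chart R M2 n2) p :
  cdom c p -> cdom d (f p) -> rep_dom f c d (c p).
Proof. by exists p. Qed.

Lemma rep_dom_open (M1 M2 : topologicalType) n1 n2 (f : M1 -> M2)
    (c : @chart R M1 n1) (d : @chart R M2 n2) : continuous f -> open (rep_dom f c d).
Proof.
move=> cf; rewrite openE => x /rep_domP[cx dx].
have h : {for x, continuous (f \o cinv c)}.
  by apply: continuous_comp; [exact: cinv_continuous|exact: cf].
have h1 := near_open (@open_cimg _ _ c) cx.
have h2 := h _ (near_open (cdom_open d) dx).
by apply: filterS2 h1 h2 => y cy dy; apply/rep_domP.
Qed.

Lemma smooth_map_id (M : topologicalType) n (S : @smooth_structure R M n) :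
  smooth_map S S id.
Proof.
split=> [x|c d ac ad]; first exact: cvg_id.
exact: (atlas_compatible ac ad).1.
Qed.

Lemma chart_at_atlas (M : topologicalType) n (S : @smooth_structure R M n) p :
  atlas S (chart_at S p).
Proof. by rewrite /chart_at; case: cid => c []. Qed.

Lemma chart_at_dom (M : topologicalType) n (S : @smooth_structure R M n) p :
  cdom (chart_at S p) p.
Proof. by rewrite /chart_at; case: cid => c []. Qed.

Lemma near_chart (M : topologicalType) n (c : @chart R M n) p (P : set M) :
  cdom c p -> nbhs p P -> \forall y \near c p, P (cinv c y).
Proof.
move=> cp nP; apply: (cinv_continuous (cdom_cimg cp)).
by rewrite cmapK.
Qed.

Lemma near_chart_img (M : topologicalType) n (c : @chart R M n) p :
  cdom c p -> \forall y \near c p, cimg c y.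
Proof. by move=> /cdom_cimg cp; exact: near_open (@open_cimg _ _ c) cp. Qed.

Lemma coord_repK (M1 M2 M3 : topologicalType) n1 n2 n3 (f : M1 -> M2) (h : M2 -> M3)
    (c : @chart R M1 n1) (d : @chart R M2 n2) (e : @chart R M3 n3) y :
  cdom d (f (cinv c y)) ->
  coord_rep h d e (coord_rep f c d y) = coord_rep (h \o f) c e y.
Proof. by move=> dy; rewrite /coord_rep /= cmapK. Qed.

Section Maps.
Context {M1 M2 : topologicalType} {n1 n2 : nat}.
Variables (S1 : @smooth_structure R M1 n1) (S2 : @smooth_structure R M2 n2).
Variables (f : M1 -> M2) (sf : smooth_map S1 S2 f).

Lemma coord_rep_diff c d x : atlas S1 c -> atlas S2 d -> rep_dom f c d x ->
  differentiable (coord_rep f c d) x.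
Proof. by move=> ac ad; exact: (sf.2 c d ac ad 1%N).1. Qed.

(** With [f] or [h] the identity, this is the effect of a change of chart on
    the source or on the target. *)
Lemma jacobian_chain (M3 : topologicalType) n3 (S3 : @smooth_structure R M3 n3)
    (h : M2 -> M3) c d e p : smooth_map S2 S3 h ->
  atlas S1 c -> atlas S2 d -> atlas S3 e ->
  cdom c p -> cdom d (f p) -> cdom e (h (f p)) ->
  'J (coord_rep (h \o f) c e) (c p) =
  'J (coord_rep f c d) (c p) *m 'J (coord_rep h d e) (d (f p)).
Proof.
move=> sh ac ad ae cp dp ep.
have df : differentiable (coord_rep f c d) (c p).
  by apply: coord_rep_diff => //; exact: rep_dom_cmap.
have fp : coord_rep f c d (c p) = d (f p) by rewrite /coord_rep /= cmapK.
have dh : differentiable (coord_rep h d e) (coord_rep f c d (c p)).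
  by rewrite fp; apply: (sh.2 d e ad ae 1%N).1; exact: rep_dom_cmap.
have near_rep : \forall y \near c p,
    (coord_rep h d e \o coord_rep f c d) y = coord_rep (h \o f) c e y.
  apply: filterS (near_chart cp (P := f @^-1` cdom d) _).
    by move=> y; exact: coord_repK.
  by apply: sf.1; exact: near_open (cdom_open d) dp.
have dc := differentiable_comp df dh.
apply: etrans (esym (near_eq_jacobian near_rep dc)) _.
by apply: etrans (jacobian_comp df dh) _; rewrite fp.
Qed.

(** The differential in the preferred charts; [dincl] is the case of the
    inclusion. *)
Definition dmap (p : M1) : 'M[R]_(n1, n2) :=
  'J (coord_rep f (chart_at S1 p) (chart_at S2 (f p))) (chart_at S1 p p).

End Maps.

Lemma jacobian_coord_rep_id (M : topologicalType) n (c : @chart R M n) p :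
  cdom c p -> 'J (coord_rep id c c) (c p) = 1%:M.
Proof.
move=> cp; apply: etrans (jacobian_id (c p)).
have E : \forall y \near c p, id y = coord_rep id c c y.
  by apply: filterS (near_chart_img cp) => y /cimgP[_ e].
by apply/esym/near_eq_jacobian.
Qed.

Section Frames.
Context {M : topologicalType} {n : nat}.
Variable S : @smooth_structure R M n.

Lemma coord_frameE c p : cdom c p ->
  coord_frame S c (c p) = 'J (coord_rep id c (chart_at S p)) (c p).
Proof. by move=> cp; rewrite /coord_frame cmapK. Qed.

Lemma coord_frame_dchart c p : atlas S c -> cdom c p ->
  coord_frame S c (c p) *m dchart S c p = 1%:M.
Proof.
move=> ac cp; rewrite coord_frameE //; apply: etrans (jacobian_coord_rep_id cp).
apply/esym; apply: (jacobian_chain (smooth_map_id S) (h := id) (d := chart_at S p)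
  (smooth_map_id S)) => //; [exact: chart_at_atlas|exact: chart_at_dom].
Qed.

Lemma dchart_coord_frame c p : atlas S c -> cdom c p ->
  dchart S c p *m coord_frame S c (c p) = 1%:M.
Proof. by move=> ac cp; apply: mulmx1C; exact: coord_frame_dchart. Qed.

Lemma jacobian_transition c d p : atlas S c -> atlas S d -> cdom c p -> cdom d p ->
  'J (coord_rep id c d) (c p) = coord_frame S c (c p) *m dchart S d p.
Proof.
move=> ac ad cp dp; rewrite coord_frameE //.
by apply: (jacobian_chain (smooth_map_id S) (h := id) (d := chart_at S p)
  (smooth_map_id S)) => //; [exact: chart_at_atlas|exact: chart_at_dom].
Qed.

End Frames.

Section Maps2.
Context {M1 M2 : topologicalType} {n1 n2 : nat}.
Variables (S1 : @smooth_structure R M1 n1) (S2 : @smooth_structure R M2 n2).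
Variables (f : M1 -> M2) (sf : smooth_map S1 S2 f).

Lemma jacobian_dmap c d p : atlas S1 c -> atlas S2 d -> cdom c p -> cdom d (f p) ->
  'J (coord_rep f c d) (c p) = coord_frame S1 c (c p) *m dmap S1 S2 f p *m dchart S2 d (f p).
Proof.
move=> ac ad cp dp; have cat := chart_at_atlas; have cad := chart_at_dom.
have E1 : 'J (coord_rep f c (chart_at S2 (f p))) (c p) =
    coord_frame S1 c (c p) *m dmap S1 S2 f p.
  rewrite coord_frameE //.
  exact: (jacobian_chain (smooth_map_id S1) (h := f) (d := chart_at S1 p) sf).
rewrite -E1.
exact: (jacobian_chain sf (h := id) (d := chart_at S2 (f p)) (smooth_map_id S2)).
Qed.

Definition isometric_for (B1 : M1 -> 'M[R]_n1) (B2 : M2 -> 'M[R]_n2) :=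
  forall p, B1 p = dmap S1 S2 f p *m B2 (f p) *m (dmap S1 S2 f p)^T.

Lemma bform_coord_pull B1 B2 c d x : isometric_for B1 B2 ->
  atlas S1 c -> atlas S2 d -> rep_dom f c d x ->
  bform_coord S1 c B1 x = 'J (coord_rep f c d) x
    *m bform_coord S2 d B2 (coord_rep f c d x) *m ('J (coord_rep f c d) x)^T.
Proof.
move=> iso ac ad [p [cp dp] <-].
have -> : coord_rep f c d (c p) = d (f p) by rewrite /coord_rep /= cmapK.
rewrite /bform_coord !cmapK // iso (jacobian_dmap ac ad cp dp).
have := dchart_coord_frame ad dp.
move: (coord_frame S1 _ _) (coord_frame S2 _ _) (dchart _ _ _) (dmap _ _ _ _) => E1 E2 D T DE.
have h : E1 *m T *m D *m E2 = E1 *m T by rewrite -mulmxA DE mulmx1.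
transitivity ((E1 *m T *m D *m E2) *m B2 (f p) *m (E1 *m T *m D *m E2)^T).
  by rewrite h (trmx_mul E1 T) !mulmxA.
by rewrite (trmx_mul (E1 *m T *m D) E2) !mulmxA.
Qed.

(** The charts of the target vary with the point, so smoothness is checked
    near each point, where the matrix of [B1] is a product of smooth ones. *)
Lemma smooth_bform_pull B1 B2 : isometric_for B1 B2 -> smooth_bform S2 B2 ->
  smooth_bform S1 B1.
Proof.
move=> iso sB2 c ac k; apply/Ck_onP => x cx.
pose d := chart_at S2 (f (cinv c x)); have ad : atlas S2 d by exact: chart_at_atlas.
have Ux : rep_dom f c d x by apply/rep_domP; split=> //; exact: chart_at_dom.
have oU := @rep_dom_open _ _ _ _ f c d sf.1.
suff h : Ck_on k (rep_dom f c d) (bform_coord S1 c B1) by exact: (Ck_onP _ _ _).1 h x Ux.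
apply: (Ck_on_eq oU (fun x Ux => esym (bform_coord_pull iso ac ad Ux))).
have sJ := Ck_on_jacobian oU (sf.2 c d ac ad k.+1).
apply: Ck_on_mulmx => //; last exact: Ck_on_trmx.
apply: Ck_on_mulmx => //.
apply: (Ck_on_comp oU (@open_cimg _ _ d) _ (sf.2 c d ac ad k) (sB2 d ad k)).
by move=> y [p [cp dp] <-]; rewrite /coord_rep /= cmapK //; exact: cdom_cimg.
Qed.

End Maps2.
End MapsInCharts.

(** * Metrics, Lorentz forces and curves in charts *)

Section MetricsAndCurves.
Context {R : realType}.

Lemma posdef_unitmx n (B : 'M[R]_n) : (forall u, u != 0 -> 0 < bform B u u) ->
  B \in unitmx.
Proof.
move=> pB; rewrite -row_free_unit; apply: inj_row_free => v vB.
apply/eqP; apply: contraT => /pB; by rewrite /bform vB mul0mx mxE ltxx.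
Qed.

Lemma posdef_eq0 n (B : 'M[R]_n) u : (forall u, u != 0 -> 0 < bform B u u) ->
  bform B u u = 0 -> u = 0.
Proof. by move=> pB u0; apply/eqP; apply: contraT => /pB; rewrite u0 ltxx. Qed.

Lemma bform_ext n (A B : 'M[R]_n) : (forall u v, bform A u v = bform B u v) -> A = B.
Proof.
move=> h; have E (C : 'M[R]_n) i j : bform C (delta_mx 0 i) (delta_mx 0 j) = C i j.
  by rewrite /bform -rowE trmx_delta -colE !mxE.
by apply/matrixP => i j; rewrite -!E.
Qed.

Section Metric.
Context {M : topologicalType} {n : nat}.
Variables (S : @smooth_structure R M n) (g : M -> 'M[R]_n).
Hypothesis mg : riemannian_metric S g.

Lemma metric_unit p : g p \in unitmx.
Proof. by case: mg => _ _ pg; exact: posdef_unitmx (pg p). Qed.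

Lemma metric_coord_sym c x : (bform_coord S c g x)^T = bform_coord S c g x.
Proof.
by case: mg => _ sg _; rewrite /bform_coord !trmx_mul trmxK sg mulmxA.
Qed.

Lemma metric_coord_pos c x u : atlas S c -> cimg c x -> u != 0 ->
  0 < bform (bform_coord S c g x) u u.
Proof.
case: mg => _ _ pg ac [p cp <-] u0; rewrite /bform_coord bform_pull; apply: pg.
apply: contra_neq u0 => /(congr1 (mulmx^~ (dchart S c p))).
by rewrite -mulmxA coord_frame_dchart // mulmx1 mul0mx.
Qed.

Lemma metric_coord_unit c x : atlas S c -> cimg c x -> bform_coord S c g x \in unitmx.
Proof. by move=> ac cx; apply: posdef_unitmx => u; exact: metric_coord_pos. Qed.

Lemma metric_coord_diff c x : atlas S c -> cimg c x -> differentiable (bform_coord S c g) x.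
Proof. by case: mg => sg _ _ ac cx; apply: (sg c ac 1%N).1. Qed.

(** The relation that defines the Lorentz force reads [Y g = s]. *)
Lemma lorentz_forceE (s : M -> 'M[R]_n) p : lorentz_force g s p = s p *m invmx (g p).
Proof.
have ug := metric_unit p.
have h Y : (forall u v, bform (g p) (u *m Y) v = bform (s p) u v) <->
    Y = s p *m invmx (g p).
  split=> [hY|->].
    have : Y *m g p = s p.
      by apply: bform_ext => u v; rewrite -hY /bform !mulmxA.
    by move=> <-; rewrite mulmxK.
  by move=> u v; rewrite /bform mulmxA mulmxKV.
rewrite /lorentz_force; case: xgetP => [Y _ /h //|/(_ (s p *m invmx (g p))) []].
exact/h.
Qed.

End Metric.

Section Isometric.
Context {M1 M2 : topologicalType} {n1 n2 : nat}.
Variables (S1 : @smooth_structure R M1 n1) (S2 : @smooth_structure R M2 n2).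
Variables (f : M1 -> M2) (sf : smooth_map S1 S2 f).
Variables (g1 : M1 -> 'M[R]_n1) (g2 : M2 -> 'M[R]_n2).
Hypotheses (mg1 : riemannian_metric S1 g1) (mg2 : riemannian_metric S2 g2).
Hypothesis iso : isometric_for S1 S2 f g1 g2.

Definition sff_coord c d : 'rV[R]_n1 -> 'rV[R]_n1 -> 'rV[R]_n2 :=
  sff_map (coord_rep f c d) (bform_coord S1 c g1) (bform_coord S2 d g2).

Lemma coord_rep_img (c : @chart R M1 n1) (d : @chart R M2 n2) x :
  rep_dom f c d x -> cimg d (coord_rep f c d x).
Proof. by move=> [p [cp dp] <-]; rewrite /coord_rep /= cmapK //; exact: cdom_cimg. Qed.

Lemma rep_dom_img (c : @chart R M1 n1) (d : @chart R M2 n2) x : rep_dom f c d x -> cimg c x.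
Proof. by move=> [p [cp dp] <-]; exact: cdom_cimg. Qed.

Lemma sff_coord_orthogonal c d x u w : atlas S1 c -> atlas S2 d -> rep_dom f c d x ->
  bform (bform_coord S2 d g2 (coord_rep f c d x)) (sff_coord c d x u)
    (w *m 'J (coord_rep f c d) x) = 0.
Proof.
move=> ac ad Ux; have oU := @rep_dom_open _ _ _ _ _ f c d sf.1.
have Vx := coord_rep_img Ux; have cx := rep_dom_img Ux.
apply: (sff_map_orthogonal u w oU Ux (sf.2 c d ac ad 2%N)).
- by move=> z Uz; exact: bform_coord_pull.
- exact: (metric_coord_diff mg1).
- exact: (metric_coord_diff mg2).
- exact: (metric_coord_sym mg2).
- exact: (metric_coord_unit mg1).
- exact: (metric_coord_unit mg2).
Qed.

Lemma curve_preimage_open (M : topologicalType) (I : set R) (gamma : R -> M) (A : set M) :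
  open I -> (forall t, I t -> {for t, continuous gamma}) -> open A ->
  open (I `&` gamma @^-1` A).
Proof.
move=> oI cg oA; rewrite openE => t [It At].
by apply: filterI; [exact: near_open oI It|exact: (cg t It _ (near_open oA At))].
Qed.

(** The Gauss formula in arbitrary charts of the source and of the target. *)
Lemma coord_acc_map (I : set R) (eta : R -> M1) c d t :
  open I -> smooth_curve_on S1 I eta -> I t -> atlas S1 c -> atlas S2 d ->
  cdom c (eta t) -> cdom d (f (eta t)) ->
  let x := c \o eta in let z := d \o f \o eta in
  derive1 z t = derive1 x t *m 'J (coord_rep f c d) (x t) /\
  coord_acc (bform_coord S2 d g2) z t =
    coord_acc (bform_coord S1 c g1) x t *m 'J (coord_rep f c d) (x t)
    + sff_coord c d (x t) (derive1 x t).
Proof.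
move=> oI [ceta seta] It ac ad ct dt x z.
pose A := cdom c `&` f @^-1` cdom d.
have oA : open A.
  apply: openI; first exact: cdom_open.
  by apply: open_comp; [move=> y _; exact: sf.1|exact: cdom_open].
pose I' := I `&` eta @^-1` A.
have oI' : open I' by exact: curve_preimage_open.
have I't : I' t by [].
have sx : Ck_on 2 I' x.
  by apply: Ck_on_subset (seta c ac 2%N) => s [Is [cs _]].
have oU := @rep_dom_open _ _ _ _ _ f c d sf.1.
have xU s : I' s -> rep_dom f c d (x s) by move=> [_ [cs ds]]; exact: rep_dom_cmap.
have zE : \forall s \near t, z s = coord_rep f c d (x s).
  apply: filterS (near_open oI' I't) => s [_ [cs ds]].
  by rewrite /coord_rep /x /z /= cmapK.
split.
  apply: velocity_comp zE; first exact: sx.1.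
  by apply: (sf.2 c d ac ad 1%N).1; exact: xU.
exact: (coord_acc_comp _ _ oI' I't sx oU (sf.2 c d ac ad 2%N) xU zE).
Qed.

Lemma smooth_curve_map (I : set R) (eta : R -> M1) : open I ->
  smooth_curve_on S1 I eta -> smooth_curve_on S2 I (f \o eta).
Proof.
move=> oI [ceta seta]; split=> [t It|d ad k].
  by apply: continuous_comp; [exact: ceta|exact: sf.1].
apply/Ck_onP => t [It dt]; pose c := chart_at S1 (eta t).
have ac : atlas S1 c by exact: chart_at_atlas.
pose A := cdom c `&` f @^-1` cdom d.
have oA : open A.
  apply: openI; first exact: cdom_open.
  by apply: open_comp; [move=> y _; exact: sf.1|exact: cdom_open].
have oI' : open (I `&` eta @^-1` A) by exact: curve_preimage_open.
have I't : (I `&` eta @^-1` A) t by split=> //; split=> //; exact: chart_at_dom.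
suff h : Ck_on k (I `&` eta @^-1` A) (d \o (f \o eta)) by exact: (Ck_onP _ _ _).1 h t I't.
have oU := @rep_dom_open _ _ _ _ _ f c d sf.1.
have sx : Ck_on k (I `&` eta @^-1` A) (c \o eta).
  by apply: Ck_on_subset (seta c ac k) => s [Is [cs _]].
have xU s : (I `&` eta @^-1` A) s -> rep_dom f c d (c (eta s)).
  by move=> [_ [cs ds]]; exact: rep_dom_cmap.
apply: Ck_on_eq (Ck_on_comp oI' oU xU sx (sf.2 c d ac ad k)) => // s [_ [cs ds]].
by rewrite /coord_rep /= cmapK.
Qed.

End Isometric.
End MetricsAndCurves.

(** * Magnetic geodesics in a chart and their existence *)

Section MagneticInCharts.
Context {R : realType}.

(** The acceleration of a magnetic geodesic in coordinates, as a function of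
    position and velocity. *)
Definition mag_field n (G S : 'rV[R]_n -> 'M[R]_n) (x v : 'rV[R]_n) : 'rV[R]_n :=
  v *m (S x *m invmx (G x)) - christoffel_apply G x v v.

Lemma smooth_christoffel n (U : set 'rV[R]_n) (G : 'rV[R]_n -> 'M[R]_n) i j l :
  open U -> (forall x, U x -> G x \in unitmx) -> smooth_on U G ->
  smooth_on U (fun x => christoffel G x i j l).
Proof.
move=> oU uG sG k.
have pG a b e : Ck_on k U (fun x => partial e (fun y => G y a b) x).
  exact: ((Ck_on_mxP _ _ oU).1 (sG k.+1) a b).2.
have sGi : Ck_on k U (fun x => invmx (G x)) by exact: Ck_on_invmx.
apply: Ck_onM => //; first exact: Ck_on_cst.
apply: Ck_on_sum => // h; apply: Ck_onM => //; last exact: (Ck_on_mxP _ _ oU).1.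
apply: Ck_onD => //; first exact: Ck_onD.
have -> : (fun x => - partial h (fun y => G y i j) x) =
    (fun x => -1 * partial h (fun y => G y i j) x).
  by apply/funext => x; rewrite mulN1r.
by apply: Ck_onM => //; exact: Ck_on_cst.
Qed.

Lemma smooth_lsubmx n (U : set 'rV[R]_(n + n)) : open U ->
  smooth_on U (fun s : 'rV[R]_(n + n) => lsubmx s).
Proof.
move=> oU k; apply/Ck_on_mxP => // i j.
under [X in Ck_on _ _ X]eq_fun do rewrite mxE.
apply: Ck_on_linear; last exact: coord_continuous.
by move=> a y z; rewrite !mxE.
Qed.

Lemma smooth_rsubmx n (U : set 'rV[R]_(n + n)) : open U ->
  smooth_on U (fun s : 'rV[R]_(n + n) => rsubmx s).
Proof.
move=> oU k; apply/Ck_on_mxP => // i j.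
under [X in Ck_on _ _ X]eq_fun do rewrite mxE.
apply: Ck_on_linear; last exact: coord_continuous.
by move=> a y z; rewrite !mxE.
Qed.

Lemma open_lsubmx n p (U : set 'rV[R]_n) : open U ->
  open [set s : 'rV[R]_(n + p) | U (lsubmx s)].
Proof. by move=> oU; apply: open_comp => // s _; exact: continuous_lsubmx. Qed.

Lemma smooth_mag_field n (U : set 'rV[R]_n) (G S : 'rV[R]_n -> 'M[R]_n) :
  open U -> (forall x, U x -> G x \in unitmx) -> smooth_on U G -> smooth_on U S ->
  smooth_on [set s : 'rV[R]_(n + n) | U (lsubmx s)]
    (fun s => mag_field G S (lsubmx s) (rsubmx s)).
Proof.
move=> oU uG sG sS k.
have oW : open [set s : 'rV[R]_(n + n) | U (lsubmx s)] by exact: open_lsubmx.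
have sl := smooth_lsubmx oW k; have sr := smooth_rsubmx oW k.
have lU s : [set s : 'rV[R]_(n + n) | U (lsubmx s)] s -> U (lsubmx s) by [].
apply/Ck_on_mxP => // a l.
have -> : (fun s : 'rV[R]_(n + n) => mag_field G S (lsubmx s) (rsubmx s) a l) =
  (fun s => (rsubmx s *m (S (lsubmx s) *m invmx (G (lsubmx s)))) a l +
    -1 * christoffel_apply G (lsubmx s) (rsubmx s) (rsubmx s) a l).
  by apply/funext => s; rewrite mulN1r [LHS]mxE [X in _ + X]mxE.
have h1 : Ck_on k [set s : 'rV[R]_(n + n) | U (lsubmx s)]
    (fun s => rsubmx s *m (S (lsubmx s) *m invmx (G (lsubmx s)))).
  apply: Ck_on_mulmx => //; apply: Ck_on_mulmx => //.
    exact: Ck_on_comp oW oU lU sl (sS k).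
  by apply: (Ck_on_comp oW oU lU sl (g := fun x => invmx (G x))); exact: Ck_on_invmx.
apply: Ck_onD => //; first exact: ((Ck_on_mxP _ _ oW).1 h1).
apply: Ck_onM => //; first exact: Ck_on_cst.
under [X in Ck_on _ _ X]eq_fun do rewrite mxE.
apply: Ck_on_sum => // i; apply: Ck_on_sum => // j; apply: Ck_onM => //.
  by apply: Ck_onM => //; exact: ((Ck_on_mxP _ _ oW).1 sr).
apply: (Ck_on_compR oW lU sl (g := fun x => christoffel G x i j l)); exact: smooth_christoffel.
Qed.

Section ChartIndependence.
Context {M : topologicalType} {n : nat}.
Variables (S : @smooth_structure R M n) (g s : M -> 'M[R]_n).
Hypothesis mg : riemannian_metric S g.

Lemma isometric_id : isometric_for S S id g g.
Proof.
move=> p; have -> : dmap S S id p = 1%:M.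
  by apply: jacobian_coord_rep_id; exact: chart_at_dom.
by rewrite mul1mx trmx1 mulmx1.
Qed.

(** The Jacobian of a change of charts is invertible, so a vector orthogonal
    to its image vanishes. *)
Lemma sff_coord_id0 c d x u : atlas S c -> atlas S d -> rep_dom id c d x ->
  sff_coord S S id g g c d x u = 0.
Proof.
move=> ac ad Ux; have [p [cp dp] xE] := Ux.
have dx := coord_rep_img Ux.
apply: (posdef_eq0 (fun u => metric_coord_pos (u := u) mg ad dx)).
set F := sff_coord _ _ _ _ _ _ _ _ _.
have FE : F = F *m coord_frame S d (d p) *m dchart S c p *m 'J (coord_rep id c d) x.
  have -> : 'J (coord_rep id c d) x = coord_frame S c (c p) *m dchart S d p.
    by rewrite -xE; exact: jacobian_transition.
  have := dchart_coord_frame ac cp; have := coord_frame_dchart ad dp.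
  move: (F) (coord_frame S d _) (dchart S d _) (dchart S c _) (coord_frame S c _).
  move=> F' E1 D2 D1 E2 ED DE.
  by rewrite mulmxA -(mulmxA _ D1) DE mulmx1 -mulmxA ED mulmx1.
rewrite [X in bform _ _ X]FE.
exact: (sff_coord_orthogonal (smooth_map_id S) mg mg isometric_id).
Qed.

Section Curve.
Variables (I : set R) (gamma : R -> M).
Hypotheses (oI : open I) (sgamma : smooth_curve_on S I gamma).

(** The covariant acceleration is defined in a chart that changes along the
    curve; this makes it computable in a fixed one. *)
Lemma acceleration_chart c t : I t -> atlas S c -> cdom c (gamma t) ->
  derive1 (c \o gamma) t = velocity S gamma t *m dchart S c (gamma t) /\
  coord_acc (bform_coord S c g) (c \o gamma) t =
    acceleration S g gamma t *m dchart S c (gamma t).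
Proof.
move=> It ac ct; pose c0 := chart_at S (gamma t).
have ac0 : atlas S c0 by exact: chart_at_atlas.
have c0t : cdom c0 (gamma t) by exact: chart_at_dom.
have [] := coord_acc_map (smooth_map_id S) g g oI sgamma It ac0 ac c0t ct.
rewrite sff_coord_id0 //; last exact: rep_dom_cmap.
by rewrite addr0.
Qed.

Lemma magnetic_in_chart c t : I t -> atlas S c -> cdom c (gamma t) ->
  acceleration S g gamma t = velocity S gamma t *m lorentz_force g s (gamma t) <->
  derive1 (derive1 (c \o gamma)) t =
    mag_field (bform_coord S c g) (bform_coord S c s) (c (gamma t)) (derive1 (c \o gamma) t).
Proof.
move=> It ac ct; have [vE aE] := acceleration_chart It ac ct.
have ED := coord_frame_dchart ac ct; have DE := dchart_coord_frame ac ct.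
have ug := metric_unit mg (gamma t).
have YE : bform_coord S c s (c (gamma t)) *m invmx (bform_coord S c g (c (gamma t))) =
    coord_frame S c (c (gamma t)) *m lorentz_force g s (gamma t) *m dchart S c (gamma t).
  rewrite (lorentz_forceE mg) /bform_coord cmapK //.
  move: ED DE ug.
  move: (coord_frame _ _ _) (dchart _ _ _) (g _) (s _) => E D G S' ED DE ug.
  have ET : E^T *m D^T = 1%:M by rewrite -trmx_mul DE trmx1.
  have uEGE : E *m G *m E^T \in unitmx.
    have [uE _] := mulmx1_unit ED.
    by rewrite !unitmx_mul uE ug unitmx_tr uE.
  apply: (canLR (mulmxK uEGE)).
  rewrite !mulmxA -(mulmxA _ D E) DE mulmx1 -(mulmxA _ (invmx G)) mulVmx // mulmx1.
  by [].
have -> : derive1 (derive1 (c \o gamma)) t = coord_acc (bform_coord S c g) (c \o gamma) t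
   - christoffel_apply (bform_coord S c g) (c (gamma t)) (derive1 (c \o gamma) t) (derive1 (c \o gamma) t).
  by rewrite /coord_acc addrK.
rewrite /mag_field aE; split=> [->|/addIr].
  by congr (_ - _); rewrite vE YE -!mulmxA (mulmxA (dchart _ _ _)) DE mul1mx.
rewrite vE YE; move: DE.
move: (acceleration _ _ _ _) (velocity _ _ _) (dchart _ _ _) (lorentz_force _ _ _).
move: (coord_frame _ _ _) => E a v D Y DE /(congr1 (mulmx^~ E)).
rewrite -mulmxA DE mulmx1 => ->.
by rewrite !mulmxA -!(mulmxA _ D E) DE !mulmx1.
Qed.

End Curve.

Lemma smooth_curve_of_chart (c : @chart R M n) (I : set R) (x : R -> 'rV[R]_n) : atlas S c ->
  open I -> smooth_on I x -> (forall t, I t -> cimg c (x t)) ->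
  smooth_curve_on S I (cinv c \o x).
Proof.
move=> ac oI sx xc.
have cx t : I t -> {for t, continuous x} by move=> It; exact: (sx 0%N).
have cg t : I t -> {for t, continuous (cinv c \o x)}.
  by move=> It; apply: continuous_comp; [exact: cx|apply: cinv_continuous; exact: xc].
split=> // d ad k.
have oI' := curve_preimage_open oI cg (cdom_open d).
have sx' : Ck_on k (I `&` (cinv c \o x) @^-1` cdom d) x.
  by apply: Ck_on_subset (sx k) => t [].
have oU : open (rep_dom id c d) by apply: rep_dom_open => y; exact: cvg_id.
have xU t : (I `&` (cinv c \o x) @^-1` cdom d) t -> rep_dom id c d (x t).
  by move=> [It dt]; apply/rep_domP; split=> //; exact: xc.
exact: Ck_on_comp oI' oU xU sx' ((smooth_map_id S).2 c d ac ad k).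
Qed.

(** Solves the equation in the preferred chart of [p]. *)
Lemma magnetic_geodesic_exists (p : M) (v : 'rV[R]_n) : smooth_bform S s ->
  exists2 T : R, 0 < T & exists gamma : R -> M, [/\ gamma 0 = p,
    velocity S gamma 0 = v &
    magnetic_geodesic S g s [set t | `|t| < T] gamma].
Proof.
move=> ss; pose c := chart_at S p.
have ac : atlas S c by exact: chart_at_atlas.
have cp : cdom c p by exact: chart_at_dom.
have oU := @open_cimg _ _ _ c; have Up := cdom_cimg cp.
have sg : smooth_bform S g by case: mg.
have sF := smooth_mag_field oU (fun x cx => metric_coord_unit mg ac cx) (sg c ac) (ss c ac).
have [T T0 [x [x0 v0 sx hx]]] := second_order_ode v oU Up sF.
exists T => //; exists (cinv c \o x).
have oI := @open_norm_lt R T.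
have T_0 : `|0 : R| < T by rewrite normr0.
have gE t : `|t| < T -> c (cinv c (x t)) = x t by move=> /hx[/cimgP[]].
have gc t : `|t| < T -> cdom c (cinv c (x t)) by move=> /hx[/cimgP[]].
have g0 : (cinv c \o x) 0 = p by rewrite /= x0 cmapK.
have sgam : smooth_curve_on S [set t | `|t| < T] (cinv c \o x).
  by apply: smooth_curve_of_chart => // t /hx[].
have nE t : `|t| < T -> \forall r \near t, (c \o (cinv c \o x)) r = x r.
  by move=> tT; apply: filterS (near_open oI tT).
have dE t : `|t| < T -> derive1 (c \o (cinv c \o x)) t = derive1 x t.
  move=> tT; apply: etrans (derive1E _ _) _; apply: etrans _ (esym (derive1E _ _)).
  exact: near_eq_derive (nE t tT).
have ddE t : `|t| < T -> derive1 (derive1 (c \o (cinv c \o x))) t = derive1 (derive1 x) t.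
  move=> tT; apply: etrans (derive1E _ _) _; apply: etrans _ (esym (derive1E _ _)).
  by apply: near_eq_derive; apply: filterS (near_open oI tT).
split=> //.
  by rewrite /velocity g0 -/c dE.
split=> //.
  by rewrite norm_lt_itv; exact: interval_is_interval.
move=> t tT; apply/(magnetic_in_chart oI sgam tT ac (gc t tT)).
by rewrite ddE // dE //= gE //; exact: (hx t tT).2.
Qed.

End ChartIndependence.
End MagneticInCharts.

(** * Embedded submanifolds and slice charts *)

Section SliceCharts.
Context {R : realType} {M : topologicalType} {k m : nat}.
Variables (SM : @smooth_structure R M (k + m)) (N : set M).
Variable SN : @smooth_structure R (set_type N) k.

Definition slice_chart (q : set_type N) (c : @chart R M (k + m))
    (b : @chart R (set_type N) k) : Prop :=
  [/\ atlas SM c, atlas SN b, cdom c (set_val q),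
      (forall p, cdom c p -> (N p <-> rsubmx (c p) = 0)) &
      forall p : set_type N,
        (cdom b p <-> cdom c (set_val p)) /\
        (cdom b p -> b p = lsubmx (c (set_val p)))].

Section Slice.
Variables (q : set_type N) (c : @chart R M (k + m)) (b : @chart R (set_type N) k).
Hypothesis sl : slice_chart q c b.

Lemma slice_dom p : cdom b p <-> cdom c (set_val p).
Proof. by case: sl => _ _ _ _ /(_ p)[]. Qed.

Lemma slice_coord p : cdom b p -> c (set_val p) = row_mx (b p) 0.
Proof.
case: sl => _ _ _ hN hb bp; have cp := (slice_dom p).1 bp.
rewrite (hb p).2 // -[LHS]hsubmxK; congr row_mx.
by apply/(hN _ cp); exact: set_valP.
Qed.

Lemma slice_center : cdom b q.
Proof. by case: sl => _ _ cq _ _; apply/slice_dom. Qed.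

(** A slice chart detects N by its last [m] coordinates, so the point with
    coordinates [(y, 0)] lies in N. *)
Lemma slice_lift y : cimg c (row_mx y 0) ->
  exists2 p : set_type N, cdom b p & b p = y.
Proof.
move=> /cimgP[cp e]; case: (sl) => _ _ _ hN hb.
have Np : N (cinv c (row_mx y 0)) by apply/(hN _ cp); rewrite e row_mxKr.
pose p : set_type N := exist (fun x => x \in N) _ (mem_set Np).
have bp : cdom b p by apply/slice_dom.
exists p => //; rewrite (hb p).2 //.
by rewrite (_ : set_val p = cinv c (row_mx y 0)) // e row_mxKl.
Qed.

End Slice.

Lemma set_val_continuous : continuous (set_val : set_type N -> M).
Proof. exact: initial_continuous. Qed.

Hypothesis emb : embedded_submanifold SM SN.

Lemma Ck_on_row_mx0 (V : normedModType R) j (U : set V) (f : V -> 'rV[R]_k) :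
  open U -> Ck_on j U f -> Ck_on j U (fun x => row_mx (f x) (0 : 'rV[R]_m)).
Proof.
move=> oU hf; apply/Ck_on_mxP => // i l; case: (split_ordP l) => l' ->.
  under [X in Ck_on _ _ X]eq_fun do rewrite row_mxEl.
  exact: ((Ck_on_mxP _ _ oU).1 hf).
under [X in Ck_on _ _ X]eq_fun do rewrite row_mxEr mxE.
exact: Ck_on_cst.
Qed.

(** Between slice charts the inclusion is [y |-> (y, 0)]; other charts are
    reached by changes of charts. *)
Lemma smooth_set_val : smooth_map SN SM set_val.
Proof.
have cval := set_val_continuous.
split=> // b0 d ab0 ad j; apply/Ck_onP => x Ux.
have [q [b0q dq] xE] := Ux.
have [c [b sl]] := emb q; have [ac ab cq _ _] := sl.
pose W := rep_dom id b0 b `&` rep_dom set_val b0 d.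
have oW : open W by apply: openI; apply: rep_dom_open => // y; exact: cvg_id.
have Wx : W x.
  split=> //; rewrite -xE; apply: rep_dom_cmap => //; exact: slice_center sl.
suff h : Ck_on j W (coord_rep set_val b0 d) by exact: (Ck_onP _ _ _).1 h x Wx.
have h1 : Ck_on j W (fun y => row_mx (coord_rep id b0 b y) (0 : 'rV[R]_m)).
  apply: Ck_on_row_mx0 => //.
  by apply: Ck_on_subset ((smooth_map_id SN).2 b0 b ab0 ab j) => y [].
have WE y : W y -> row_mx (coord_rep id b0 b y) 0 = c (set_val (cinv b0 y)) /\
    cdom c (set_val (cinv b0 y)) /\ cdom d (set_val (cinv b0 y)).
  move=> [/rep_domP[_ bp] /rep_domP[_ dp]].
  by rewrite (slice_coord sl bp); split=> //; split=> //; apply/(slice_dom sl).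
have oU : open (rep_dom id c d) by apply: rep_dom_open => y; exact: cvg_id.
have WU y : W y -> rep_dom id c d (row_mx (coord_rep id b0 b y) 0).
  by move=> /WE[-> [cp dp]]; exact: rep_dom_cmap.
apply: Ck_on_eq (Ck_on_comp oW oU WU h1 ((smooth_map_id SM).2 c d ac ad j)) => //.
by move=> y /WE[-> [cp dp]]; rewrite /coord_rep /= cmapK.
Qed.

(** The retraction forgets the last [m] coordinates of a slice chart. It shows
    that the inclusion is an immersion, and that the coordinates in N of a
    curve of M lying in N are smooth. *)
Lemma local_retraction (q : set_type N) b0 d : atlas SN b0 -> atlas SM d ->
  cdom b0 q -> cdom d (set_val q) ->
  exists psi : 'rV[R]_(k + m) -> 'rV[R]_k, exists V : set 'rV[R]_(k + m),
    [/\ open V, smooth_on V psi, V (d (set_val q)) &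
    forall p : set_type N, cdom d (set_val p) -> V (d (set_val p)) ->
      cdom b0 p /\ psi (d (set_val p)) = b0 p].
Proof.
move=> ab0 ad b0q dq; have [c [b sl]] := emb q; have [ac ab cq _ _] := sl.
have oUM : open (rep_dom id d c) by apply: rep_dom_open => y; exact: cvg_id.
have oUN : open (rep_dom id b b0) by apply: rep_dom_open => y; exact: cvg_id.
pose V := [set z | rep_dom id d c z /\ rep_dom id b b0 (lsubmx (coord_rep id d c z))].
have smc := (smooth_map_id SM).2 d c ad ac.
have sl1 : smooth_on (rep_dom id d c) (fun z => lsubmx (coord_rep id d c z) : 'rV[R]_k).
  move=> j; apply/Ck_on_mxP => // i l.
  under [X in Ck_on _ _ X]eq_fun do rewrite mxE.
  exact: ((Ck_on_mxP _ _ oUM).1 (smc j)).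
have oV : open V.
  rewrite openE => z [Uz Vz]; apply: filterI; first exact: near_open oUM Uz.
  exact: (sl1 0%N z Uz _ (near_open oUN Vz)).
have dE p : cdom d p -> coord_rep id d c (d p) = c p by move=> dp; rewrite /coord_rep /= cmapK.
exists (fun z => coord_rep id b b0 (lsubmx (coord_rep id d c z))), V; split=> //.
- move=> j; apply: (Ck_on_comp oV oUN _ _ ((smooth_map_id SN).2 b b0 ab ab0 j)).
    by move=> z [].
  by apply: Ck_on_subset (sl1 j) => z [].
- split; first exact: rep_dom_cmap.
  rewrite dE // (slice_coord sl (slice_center sl)) row_mxKl.
  by apply: rep_dom_cmap => //; exact: slice_center sl.
- move=> p dp [/rep_domP[_ cp]]; rewrite cmapK // in cp.
  have bp : cdom b p by apply/(slice_dom sl).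
  rewrite dE // (slice_coord sl bp) row_mxKl => /rep_domP[_].
  by rewrite /coord_rep /= cmapK.
Qed.

Lemma jacobian_set_val_linv (q : set_type N) b0 d : atlas SN b0 -> atlas SM d ->
  cdom b0 q -> cdom d (set_val q) ->
  exists K, 'J (coord_rep set_val b0 d) (b0 q) *m K = 1%:M.
Proof.
move=> ab0 ad b0q dq.
have [psi [V [oV spsi Vq psiE]]] := local_retraction ab0 ad b0q dq.
exists ('J psi (d (set_val q))).
have Uq : rep_dom set_val b0 d (b0 q) by exact: rep_dom_cmap.
have df := coord_rep_diff smooth_set_val ab0 ad Uq.
have fq : coord_rep set_val b0 d (b0 q) = d (set_val q) by rewrite /coord_rep /= cmapK.
have dpsi : differentiable psi (coord_rep set_val b0 d (b0 q)).
  by rewrite fq; apply: (spsi 1%N).1.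
have nE : \forall y \near b0 q, (psi \o coord_rep set_val b0 d) y = id y.
  have h1 := near_chart_img b0q.
  have h2 : \forall y \near b0 q, V (coord_rep set_val b0 d y).
    apply: (differentiable_continuous df); rewrite fq; exact: near_open oV Vq.
  have oU := @rep_dom_open _ _ _ _ _ _ b0 d set_val_continuous.
  have h3 := near_open oU Uq.
  apply: filterS3 h1 h2 h3 => y /cimgP[_ e] Vy /rep_domP[_ dy].
  by have [_ /= ->] := psiE _ dy Vy.
have dc := differentiable_comp df dpsi.
rewrite -fq; apply: etrans (esym (jacobian_comp df dpsi)) _.
by apply: etrans (near_eq_jacobian nE dc) _; exact: jacobian_id.
Qed.

Lemma jacobian_row_mx0 (y : 'rV[R]_k) :
  'J (fun z : 'rV[R]_k => row_mx z (0 : 'rV[R]_m)) y = row_mx 1%:M 0.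
Proof.
have lin : linear (fun z : 'rV[R]_k => row_mx z (0 : 'rV[R]_m)).
  by move=> a u v; rewrite scale_row_mx add_row_mx scaler0 addr0.
have cont : continuous (fun z : 'rV[R]_k => row_mx z (0 : 'rV[R]_m)).
  move=> z; apply: (Ck_on_row_mx0 (j := 0) openT _ : Ck_on 0 setT _) => //.
  by move=> ? _; exact: cvg_id.
apply/row_matrixP => i; rewrite !rowE mul_mx_row mulmx1 mulmx0.
have [d e] := linear_derive y (delta_mx 0 i) lin cont.
exact: etrans (esym (deriveEjacobian _ d)) e.
Qed.

End SliceCharts.

(** * Pulled-back metrics and the second fundamental form *)

Section Pullback.
Context {R : realType} {M : topologicalType} {k m : nat}.
Variables (SM : @smooth_structure R M (k + m)) (N : set M).
Variable SN : @smooth_structure R (set_type N) k.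
Hypothesis emb : embedded_submanifold SM SN.

Lemma isometric_pullback (B : M -> 'M[R]_(k + m)) :
  isometric_for SN SM set_val (pullback SM SN B) B.
Proof. by []. Qed.

Lemma dincl_linv q : exists K, dincl SM SN q *m K = 1%:M.
Proof.
by apply: (jacobian_set_val_linv emb);
  [exact: chart_at_atlas|exact: chart_at_atlas|exact: chart_at_dom|exact: chart_at_dom].
Qed.

Lemma dincl_inj q (u v : 'rV[R]_k) : u *m dincl SM SN q = v *m dincl SM SN q -> u = v.
Proof.
have [K] := dincl_linv q; move: (dincl _ _ _) => D DK.
by move=> /(congr1 (mulmx^~ K)); rewrite -!mulmxA DK !mulmx1.
Qed.

Lemma smooth_pullback B : smooth_bform SM B -> smooth_bform SN (pullback SM SN B).
Proof. exact: (smooth_bform_pull (smooth_set_val emb) (@isometric_pullback B)). Qed.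

Lemma riemannian_pullback g : riemannian_metric SM g ->
  riemannian_metric SN (pullback SM SN g).
Proof.
move=> [sg symg pg]; split; first exact: smooth_pullback.
  by move=> q; rewrite /pullback !trmx_mul trmxK symg mulmxA.
move=> q u u0; rewrite /pullback bform_pull; apply: pg.
by apply: contra_neq u0 => e; apply: (@dincl_inj q); rewrite e mul0mx.
Qed.

Section SecondFundamentalForm.
Variables (g : M -> 'M[R]_(k + m)).

Definition sff_at (q : set_type N) : 'rV[R]_k -> 'rV[R]_(k + m) :=
  sff_coord SN SM set_val (pullback SM SN g) g (chart_at SN q)
    (chart_at SM (set_val q)) (chart_at SN q q).

Lemma dchart_chart_at (M' : topologicalType) n (S : @smooth_structure R M' n) p :
  dchart S (chart_at S p) p = 1%:M.
Proof. by apply: jacobian_coord_rep_id; exact: chart_at_dom. Qed.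

(** Tangency in the preferred charts, transported to the charts [b] and [c]. *)
Lemma vf_coord_pull (V : M -> 'rV[R]_(k + m)) (W : set_type N -> 'rV[R]_k) b c p :
  atlas SN b -> atlas SM c -> cdom b p -> cdom c (set_val p) ->
  V (set_val p) = W p *m dincl SM SN p ->
  vf_coord SM c V (coord_rep set_val b c (b p)) =
  vf_coord SN b W (b p) *m 'J (coord_rep set_val b c) (b p).
Proof.
move=> ab ac bp cp VW; rewrite (jacobian_dmap (smooth_set_val emb) ab ac bp cp).
have -> : coord_rep set_val b c (b p) = c (set_val p) by rewrite /coord_rep /= cmapK.
rewrite /vf_coord !cmapK // VW -[dincl SM SN p]/(dmap SN SM set_val p).
have := dchart_coord_frame ab bp.
move: (dmap _ _ _ _) (dchart SM _ _) (dchart SN _ _) (coord_frame _ _ _) (W p).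
by move=> T D D' E w DE; rewrite !mulmxA -(mulmxA w D') DE mulmx1.
Qed.

(** In coordinates the extension is [W] times the Jacobian of the inclusion.
    Differentiating this product, the derivative of [W] appears in both
    covariant derivatives and cancels; what remains depends on [v] alone. *)
Lemma tangent_extension_sff q v V W : tangent_extension SM SN q v V W ->
  covariant_derivative SM g V (set_val q) (v *m dincl SM SN q)
    - covariant_derivative SN (pullback SM SN g) W q v *m dincl SM SN q = sff_at q v.
Proof.
move=> [Wq [U [oU Uq sV VW]]].
pose b := chart_at SN q; pose c := chart_at SM (set_val q).
have ab : atlas SN b by exact: chart_at_atlas.
have ac : atlas SM c by exact: chart_at_atlas.
have bq : cdom b q by exact: chart_at_dom.
have cq : cdom c (set_val q) by exact: chart_at_dom.
pose phi := coord_rep set_val b c; pose y0 := b q.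
have phiy0 : phi y0 = c (set_val q) by rewrite /phi /coord_rep /= cmapK.
pose vc := vf_coord SM c V; pose wb := vf_coord SN b W.
have Vq : V (set_val q) = v *m dincl SM SN q by rewrite VW // Wq.
have sval := smooth_set_val emb.
have oD := @rep_dom_open _ _ _ _ _ _ b c (@set_val_continuous M N).
have Dy0 : rep_dom set_val b c y0 by exact: rep_dom_cmap.
have dphi : differentiable phi y0 by exact: (coord_rep_diff sval ab ac Dy0).
have dJ : differentiable (fun y => 'J phi y) y0.
  by apply: (Ck_on_jacobian oD (sval.2 b c ab ac 2%N)).1.
have dvc : differentiable vc (phi y0).
  by rewrite phiy0; apply: (sV c ac 1%N).1; exists (set_val q).
have nphi : {for y0, continuous phi} := differentiable_continuous dphi.
have nU : \forall y \near y0, U (set_val (cinv b y)).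
  apply: (near_chart bq (P := fun p => U (set_val p))).
  by apply: (@set_val_continuous M N q); exact: near_open oU Uq.
have vwE : \forall y \near y0, vc (phi y) = wb y *m 'J phi y.
  apply: filterS2 (near_open oD Dy0) nU => y [p [bp cp] <-] Up.
  have Up' : U (set_val p) by rewrite -(cmapK bp).
  exact: (vf_coord_pull ab ac bp cp (VW p Up')).
(* Only the smoothness of the ambient field is assumed; the derivative of the
   retraction recovers [W] from it. *)
have dwb : differentiable wb y0.
  have [psi [A [oA spsi Aq psiE]]] := local_retraction emb ab ac bq cq.
  have dpsi : differentiable (fun z => 'J psi z) (phi y0).
    by rewrite phiy0; apply: (Ck_on_jacobian oA (spsi 2%N)).1.
  have e : \forall y \near y0, vc (phi y) *m 'J psi (phi y) = wb y.
    have nA : \forall y \near y0, A (phi y).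
      by apply: nphi; rewrite phiy0; exact: near_open oA Aq.
    have nAA := nbhs_interior nA.
    apply: filterS3 vwE nAA (near_open oD Dy0) => y -> Ay Dy.
    have dphi' : differentiable phi y by exact: (coord_rep_diff sval ab ac Dy).
    have dpsi' : differentiable psi (phi y).
      by apply: (spsi 1%N).1; exact: (nbhs_singleton Ay).
    have nid : \forall z \near y, (psi \o phi) z = id z.
      apply: filterS2 Ay (near_open oD Dy) => z Az [p [bp cp] pz].
      move: Az; rewrite -pz /= /phi /coord_rep /= cmapK // => Az.
      by have [_ ->] := psiE p cp Az.
    have dc := differentiable_comp dphi' dpsi'.
    rewrite -mulmxA -[RHS]mulmx1; congr (_ *m _).
    apply: etrans (esym (jacobian_comp dphi' dpsi')) _.
    by apply: etrans (near_eq_jacobian nid dc) _; exact: jacobian_id.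
  apply: near_eq_differentiable e _; apply: differentiable_mulmx.
    exact: differentiable_comp dphi dvc.
  exact: differentiable_comp dphi dpsi.
have Dwb : is_derive y0 v wb ('D_v wb y0) by apply/derivableP/diff_derivable.
have DJ : is_derive y0 v (fun y => 'J phi y) ('D_v (fun y => 'J phi y) y0).
  by apply/derivableP/diff_derivable.
have [_ D1] := is_derive_mulmx Dwb DJ.
have [_ D2] := is_derive_comp v dphi dvc.
have wb0 : wb y0 = v.
  rewrite /wb /vf_coord /y0 (cmapK bq) Wq.
  by apply: etrans (congr1 (mulmx v) (dchart_chart_at SN q)) _; rewrite mulmx1.
have Dphi : 'D_v phi y0 = v *m dincl SM SN q by exact: (deriveEjacobian v dphi).
have key : 'D_(v *m dincl SM SN q) vc (c (set_val q)) =
   'D_v wb y0 *m dincl SM SN q + v *m 'D_v (fun y => 'J phi y) y0.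
  have E3 : 'D_('D_v phi y0) vc (phi y0) = 'D_v wb y0 *m 'J phi y0 + wb y0 *m 'D_v (fun y => 'J phi y) y0.
    apply: etrans (esym D2) _; apply: etrans D1; exact: near_eq_derive.
  by move: E3; rewrite Dphi phiy0 wb0.
rewrite /covariant_derivative /sff_at /sff_coord /sff_map Vq Wq.
rewrite -/b -/c -/phi -/vc -/wb -/y0.
rewrite phiy0.
rewrite -[X in _ *m X + christoffel_apply _ _ _ _]/('D_v (fun y => 'J phi y) y0).
rewrite -[jacobian _ y0]/(dincl SM SN q).
move: key; set E := 'D_(_ *m _) vc _; move=> ->.
move: ('D_v wb y0) => A1; move: (v *m 'D_v _ y0) => A2.
move: (christoffel_apply _ _ _ _) (christoffel_apply _ _ _ _) => C1 C2.
rewrite mulmxDl; move: (_ *m _) (_ *m _) => X Y.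
by rewrite -(addrA Y) [Y + _]addrC opprD addrA addrK.
Qed.

End SecondFundamentalForm.
End Pullback.

(** * Tangent extensions and the three conditions on the force *)

Section SliceExtension.
Context {R : realType} {M : topologicalType} {k m : nat}.
Variables (SM : @smooth_structure R M (k + m)) (N : set M).
Variable SN : @smooth_structure R (set_type N) k.
Hypothesis emb : embedded_submanifold SM SN.

Lemma slice_jacobian q c b p : slice_chart SM SN q c b -> cdom b p ->
  'J (coord_rep set_val b c) (b p) = row_mx 1%:M 0.
Proof.
move=> sl bp; have cp := (slice_dom sl p).1 bp; have [ac ab _ _ _] := sl.
have Up : rep_dom set_val b c (b p) by exact: rep_dom_cmap.
have d := coord_rep_diff (smooth_set_val emb) ab ac Up.
have nE : \forall y \near b p, coord_rep set_val b c y = row_mx y 0.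
  apply: filterS (near_chart_img bp) => y [r br <-].
  by rewrite /coord_rep /= cmapK // (slice_coord sl br).
by apply: etrans (near_eq_jacobian nE d) _; exact: jacobian_row_mx0.
Qed.

Lemma slice_dincl q c b p : slice_chart SM SN q c b -> cdom b p ->
  coord_frame SN b (b p) *m dincl SM SN p =
  row_mx 1%:M 0 *m coord_frame SM c (c (set_val p)).
Proof.
move=> sl bp; have cp := (slice_dom sl p).1 bp; have [ac ab _ _ _] := sl.
have := jacobian_dmap (smooth_set_val emb) ab ac bp cp.
rewrite (slice_jacobian sl bp) -[dmap _ _ _ _]/(dincl SM SN p) => ->.
have := dchart_coord_frame ac cp.
move: (dincl _ _ _) (dchart _ _ _) (coord_frame SN _ _) (coord_frame _ _ _).
by move=> T D E E' DE; rewrite -mulmxA DE mulmx1.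
Qed.

Lemma slice_velocity q c b p u : slice_chart SM SN q c b -> cdom b p ->
  u *m dincl SM SN p *m dchart SM c (set_val p) = row_mx (u *m dchart SN b p) (0 : 'rV[R]_m).
Proof.
move=> sl bp; have cp := (slice_dom sl p).1 bp; have [ac ab _ _ _] := sl.
have := slice_dincl sl bp; have := dchart_coord_frame ab bp.
have := coord_frame_dchart ac cp.
move: (dincl _ _ _) (dchart SN _ _) (coord_frame SN _ _) (dchart _ _ _) (coord_frame _ _ _).
move=> T D E D' E' ED' DE ET.
have -> : T = D *m row_mx 1%:M (0 : 'M[R]_(k, m)) *m E' by rewrite -mulmxA -ET mulmxA DE mul1mx.
by rewrite !mulmxA -(mulmxA _ E') ED' mulmx1 mul_mx_row mulmx1 mulmx0.
Qed.

(** The field whose coordinates in a slice chart are constant, with vanishing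
    last [m] coordinates, is tangent to N. *)
Lemma tangent_extension_exists q v : exists V W, tangent_extension SM SN q v V W.
Proof.
have [c [b sl]] := emb q; have [ac ab cq _ _] := sl; have bq := slice_center sl.
pose v' := v *m dchart SN b q.
exists (fun p => row_mx v' 0 *m coord_frame SM c (c p)).
exists (fun p => v' *m coord_frame SN b (b p)); split.
  change (v' *m coord_frame SN b (b q) = v).
  have := dchart_coord_frame ab bq; rewrite /v'.
  move: (dchart _ _ _) (coord_frame _ _ _) => D E DE.
  by rewrite -mulmxA DE mulmx1.
exists (cdom c); split=> //.
- exact: cdom_open.
- move=> d ad j.
  have oU : open (rep_dom id d c) by apply: rep_dom_open => y; exact: cvg_id.
  have oU' : open (rep_dom id c d) by apply: rep_dom_open => y; exact: cvg_id.
  have s1 := (smooth_map_id SM).2 d c ad ac j.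
  have s2 := (smooth_map_id SM).2 c d ac ad j.+1.
  have UU y : rep_dom id d c y -> rep_dom id c d (coord_rep id d c y).
    move=> [p [dp cp] <-]; rewrite (_ : coord_rep id d c (d p) = c p).
      exact: rep_dom_cmap.
    by rewrite /coord_rep /= cmapK.
  have sJ := Ck_on_comp oU oU' UU s1 (Ck_on_jacobian oU' s2).
  have h := Ck_on_mulmx oU (Ck_on_cst j (rep_dom id d c) (row_mx v' 0)) sJ.
  change (Ck_on j (rep_dom id d c)
    (vf_coord SM d (fun p => row_mx v' 0 *m coord_frame SM c (c p)))).
  apply: Ck_on_eq oU _ h => y [p [dp cp] <-].
  have -> : coord_rep id d c (d p) = c p by rewrite /coord_rep /= cmapK.
  rewrite (jacobian_transition ac ad cp dp) /vf_coord (cmapK dp).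
  exact: mulmxA.
- move=> p cp; have bp : cdom b p by apply/(slice_dom sl).
  change (row_mx v' 0 *m coord_frame SM c (c (set_val p)) =
    v' *m coord_frame SN b (b p) *m dincl SM SN p).
  apply: etrans _ (mulmxA _ _ _).
  apply: etrans _ (congr1 (mulmx v') (esym (slice_dincl sl bp))).
  by rewrite mulmxA mul_mx_row mulmx1 mulmx0.
Qed.

(** All extensions give the same vector, and there is one, so the choice made
    in the definition does not matter. *)
Lemma second_fundamental_formE g q v :
  second_fundamental_form SM SN g q v = sff_at SM SN g q v.
Proof.
rewrite /second_fundamental_form; case: xgetP => [w _ [V [W [ext ->]]]|h].
  exact: tangent_extension_sff ext.
have [V [W ext]] := tangent_extension_exists q v.
have [] := h (covariant_derivative SM g V (set_val q) (v *m dincl SM SN q)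
        - covariant_derivative SN (pullback SM SN g) W q v *m dincl SM SN q).
by exists V, W.
Qed.

Section Magnetic.
Variables (g s : M -> 'M[R]_(k + m)).
Hypothesis mg : riemannian_metric SM g.

Let gN := pullback SM SN g.
Let sN := pullback SM SN s.
Let mgN : riemannian_metric SN gN := riemannian_pullback emb mg.

Lemma lorentz_form p u v : bform (g p) (u *m lorentz_force g s p) v = bform (s p) u v.
Proof.
rewrite (lorentz_forceE mg) /bform !mulmxA; have := metric_unit mg p.
by move: (g p) (s p) => G S uG; rewrite mulmxKV.
Qed.

(** The difference of the two forces is normal to N: on tangent vectors both
    are represented by the two-form of M. *)
Lemma lorentz_tangential q u w :
  bform (g (set_val q)) (u *m lorentz_force gN sN q *m dincl SM SN q
    - u *m dincl SM SN q *m lorentz_force g s (set_val q)) (w *m dincl SM SN q) = 0.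
Proof.
rewrite bformBl lorentz_form -bform_pull -/(pullback SM SN g q) -/gN.
rewrite (lorentz_forceE mgN) -bform_pull -/(pullback SM SN s q) -/sN.
have := metric_unit mgN q; move: (gN q) (sN q) => G S uG.
by rewrite /bform mulmxA mulmxKV // subrr.
Qed.

Lemma metric_pos p u : u != 0 -> 0 < bform (g p) u u.
Proof. by case: mg => _ _ pg; exact: pg. Qed.

Let forces_agree := forall (q : set_type N) (v : 'rV[R]_k),
    v *m lorentz_force gN sN q *m dincl SM SN q =
    v *m dincl SM SN q *m lorentz_force g s (set_val q).
Let force_tangent := forall (q : set_type N) (v : 'rV[R]_(k + m)),
    tangent SM SN q v -> tangent SM SN q (v *m lorentz_force g s (set_val q)).
Let orthogonals_agree := forall (q : set_type N) (u v : 'rV[R]_(k + m)),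
    tangent SM SN q u -> orthogonal_tangent SM SN g q v ->
    bform (s (set_val q)) u v = 0.

Lemma lorentz_equal_invariant : forces_agree -> force_tangent.
Proof. by move=> ha q _ [u _ <-]; exists (u *m lorentz_force gN sN q). Qed.

Lemma lorentz_invariant_orthogonal : force_tangent -> orthogonals_agree.
Proof.
move=> hb q u v /hb Tu ov; rewrite -lorentz_form.
exact: ov.
Qed.

(** The difference [r] of the two sides is normal to N, so its square norm is
    [- g(v D Y_M, r) = - s(v D, r)], which vanishes by assumption. *)
Lemma lorentz_orthogonal_equal : orthogonals_agree -> forces_agree.
Proof.
move=> hc q v; apply/subr0_eq; set r := _ - _.
apply: (posdef_eq0 (@metric_pos (set_val q))).
have ro w : bform (g (set_val q)) r (w *m dincl SM SN q) = 0 by exact: lorentz_tangential.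
have sg : (g (set_val q))^T = g (set_val q) by case: mg.
have orth : orthogonal_tangent SM SN g q r.
  by move=> _ [w _ <-]; rewrite bform_sym.
rewrite {1}/r bformBl lorentz_form (hc q) //; last by exists v.
by rewrite subr0 bform_sym.
Qed.

End Magnetic.
End SliceExtension.

(** * Parity of the second fundamental form; curves in charts *)

Section Auxiliary.
Context {R : realType}.

Lemma christoffel_applyN n (G : 'rV[R]_n -> 'M[R]_n) x u :
  christoffel_apply G x (- u) (- u) = christoffel_apply G x u u.
Proof.
apply/rowP => l; rewrite !mxE; apply: eq_bigr => i _; apply: eq_bigr => j _.
by rewrite !mxE mulrNN.
Qed.

Lemma sff_map_even n p (U : set 'rV[R]_n) (phi : 'rV[R]_n -> 'rV[R]_p) G1 G2 y u :
  open U -> U y -> Ck_on 2 U phi -> sff_map phi G1 G2 y (- u) = sff_map phi G1 G2 y u.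
Proof.
move=> oU Uy hphi; rewrite /sff_map !mulNmx !christoffel_applyN.
have dJ : differentiable (fun z => 'J phi z) y by apply: (Ck_on_jacobian oU hphi).1.
have e : 'D_(- u) (fun z => 'J phi z) y = - 'D_u (fun z => 'J phi z) y.
  by rewrite -scaleN1r (derive_scale_dir _ _ dJ) scaleN1r.
by rewrite e mulmxN opprK.
Qed.

Lemma derive1_rsubmx a b (z : R -> 'rV[R]_(a + b)) t : differentiable z t ->
  is_derive t (1 : R) (fun r => rsubmx (z r)) (rsubmx (derive1 z t)).
Proof.
move=> dz.
have lin : linear (fun A : 'rV[R]_(a + b) => rsubmx A).
  by move=> c A B; apply/rowP => j; rewrite !mxE.
have cont : continuous (fun A : 'rV[R]_(a + b) => rsubmx A) by exact: continuous_rsubmx.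
have [dr e] := linear_derive (z t) (derive1 z t) lin cont.
by have := is_derive_comp (1 : R) dz dr; rewrite -derive1E e.
Qed.

Lemma is_derive_row_mx a b (A : R -> 'rV[R]_a) (B : R -> 'rV[R]_b) dA dB t :
  is_derive t (1 : R) A dA -> is_derive t (1 : R) B dB ->
  is_derive t (1 : R) (fun s => row_mx (A s) (B s)) (row_mx dA dB).
Proof.
move=> [hA <-] [hB <-].
have dE i j : is_derive t (1 : R) (fun s => row_mx (A s) (B s) i j)
    (row_mx ('D_1 A t) ('D_1 B t) i j).
  case: (split_ordP j) => l ->.
    under eq_fun do rewrite row_mxEl.
    rewrite row_mxEl; split; first exact: (derivable_mxP _ _ _).1.
    by rewrite derive_mx // mxE.
  under eq_fun do rewrite row_mxEr.
  rewrite row_mxEr; split; first exact: (derivable_mxP _ _ _).1.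
  by rewrite derive_mx // mxE.
have d : derivable (fun s => row_mx (A s) (B s)) t 1.
  by apply/derivable_mxP => i j; have [] := dE i j.
split=> //; rewrite derive_mx //; apply/matrixP => i j; rewrite mxE.
by have [] := dE i j.
Qed.

Lemma Ck_on_derive1 n (I : set R) (z : R -> 'rV[R]_n) : Ck_on 2 I z ->
  forall t, I t -> differentiable z t /\ differentiable (derive1 z) t.
Proof.
move=> hz t It; split; first exact: hz.1.
have -> : derive1 z = (fun s => 'D_1 z s) by apply/funext => s; rewrite derive1E.
exact: (hz.2 1).1.
Qed.

Lemma chart_preimage_open (M : topologicalType) n (c : @chart R M n) (V : set 'rV[R]_n) :
  open V -> open (cdom c `&` c @^-1` V).
Proof.
move=> oV; rewrite openE => p [cp Vp]; apply: filterI.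
  exact: near_open (cdom_open c) cp.
exact: (cmap_continuous cp (near_open oV Vp)).
Qed.

Lemma bform_coord_chart_at (M : topologicalType) n (S : @smooth_structure R M n)
    (B : M -> 'M[R]_n) p : bform_coord S (chart_at S p) B (chart_at S p p) = B p.
Proof.
have cp := chart_at_dom S p; rewrite /bform_coord (cmapK cp).
have -> : coord_frame S (chart_at S p) (chart_at S p p) = 1%:M.
  rewrite (coord_frameE S cp); exact: jacobian_coord_rep_id.
by rewrite mul1mx trmx1 mulmx1.
Qed.

End Auxiliary.

(** * The equation of magnetic geodesics split along N *)

Section Decomposition.
Context {R : realType} {M : topologicalType} {k m : nat}.
Variables (SM : @smooth_structure R M (k + m)) (N : set M).
Variable SN : @smooth_structure R (set_type N) k.
Hypothesis emb : embedded_submanifold SM SN.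
Variables (g s : M -> 'M[R]_(k + m)).
Hypotheses (mg : riemannian_metric SM g) (ss : smooth_bform SM s).

Let gN := pullback SM SN g.
Let sN := pullback SM SN s.
Let mgN : riemannian_metric SN gN := riemannian_pullback emb mg.
Let ssN : smooth_bform SN sN := smooth_pullback emb ss.

Lemma sff_at_orthogonal q u w :
  bform (g (set_val q)) (sff_at SM SN g q u) (w *m dincl SM SN q) = 0.
Proof.
have ab := chart_at_atlas SN q; have ac := chart_at_atlas SM (set_val q).
have bq := chart_at_dom SN q; have cq := chart_at_dom SM (set_val q).
have Uq := rep_dom_cmap (f := set_val) bq cq.
have := sff_coord_orthogonal (smooth_set_val emb) mgN mg
  (@isometric_pullback _ _ _ _ SM N SN g) u w ab ac Uq.
have -> : coord_rep set_val (chart_at SN q) (chart_at SM (set_val q)) (chart_at SN q q)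
    = chart_at SM (set_val q) (set_val q) by rewrite /coord_rep /= cmapK.
by rewrite bform_coord_chart_at.
Qed.

Lemma sff_at_even q u : sff_at SM SN g q (- u) = sff_at SM SN g q u.
Proof.
have ab := chart_at_atlas SN q; have ac := chart_at_atlas SM (set_val q).
have bq := chart_at_dom SN q; have cq := chart_at_dom SM (set_val q).
have Uq := rep_dom_cmap (f := set_val) bq cq.
have oU := @rep_dom_open _ _ _ _ _ _ (chart_at SN q) (chart_at SM (set_val q))
  (@set_val_continuous M N).
exact: (sff_map_even _ _ _ oU Uq ((smooth_set_val emb).2 _ _ ab ac 2%N)).
Qed.

(** Since both [II(v)] and [v D Y_M - v Y_N D] are normal to N, the assumed
    decomposition identifies them. The first is even in [v] and the second is
    linear, so they vanish. *)
Lemma normal_decomposition q :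
  (forall v, exists a, v *m dincl SM SN q *m lorentz_force g s (set_val q) =
     a *m dincl SM SN q + sff_at SM SN g q v) ->
  forall v, sff_at SM SN g q v = 0 /\
    v *m lorentz_force gN sN q *m dincl SM SN q =
    v *m dincl SM SN q *m lorentz_force g s (set_val q).
Proof.
move=> h.
have E v : sff_at SM SN g q v = v *m dincl SM SN q *m lorentz_force g s (set_val q)
    - v *m lorentz_force gN sN q *m dincl SM SN q.
  have [a ha] := h v.
  have lt := lorentz_tangential emb s mg q v; rewrite -/gN -/sN in lt.
  have so := sff_at_orthogonal q v.
  move: ha lt so; move: (v *m lorentz_force gN sN q) => y.
  move: (sff_at _ _ _ _ _) => F ->; move: (dincl _ _ _) => D lt so.
  suff e : (y - a) *m D = 0.
    by move/eqP: e; rewrite mulmxBl subr_eq0 => /eqP ->; rewrite [_ + F]addrC addrK.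
  apply: (posdef_eq0 (metric_pos mg (set_val q))).
  have := lt (y - a).
  have -> : y *m D - (a *m D + F) = (y - a) *m D - F by rewrite mulmxBl opprD addrA.
  by rewrite bformBl so subr0.
move=> v; have e0 : sff_at SM SN g q v = 0.
  have e1 : sff_at SM SN g q v = - sff_at SM SN g q v.
    apply: etrans (esym (sff_at_even q v)) _; apply: etrans (E (- v)) _.
    by rewrite (E v) !mulNmx opprB opprK addrC.
  apply/rowP => j; rewrite [RHS]mxE; move/rowP : e1 => /(_ j).
  by rewrite [RHS]mxE; lra.
split=> //; apply/esym/subr0_eq; rewrite -E; exact: e0.
Qed.

Section Curve.
Variables (I : set R) (eta : R -> set_type N).
Hypotheses (oI : open I) (seta : smooth_curve_on SN I eta).

(** The Gauss formula in the preferred charts, which are those used by the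
    definitions of velocity and acceleration. *)
Lemma incl_velocity_acceleration t : I t ->
  velocity SM (set_val \o eta) t = velocity SN eta t *m dincl SM SN (eta t) /\
  acceleration SM g (set_val \o eta) t =
    acceleration SN gN eta t *m dincl SM SN (eta t)
    + sff_at SM SN g (eta t) (velocity SN eta t).
Proof.
move=> It; exact: (coord_acc_map (smooth_set_val emb) gN g oI seta It
  (chart_at_atlas SN (eta t)) (chart_at_atlas SM (set_val (eta t)))
  (chart_at_dom SN (eta t)) (chart_at_dom SM (set_val (eta t)))).
Qed.

End Curve.

Let geodesics_included := forall (I : set R) (gamma : R -> set_type N),
    magnetic_geodesic SN gN sN I gamma ->
    magnetic_geodesic SM g s I (set_val \o gamma).

Lemma geodesics_included_of_extrinsic :
  (forall (q : set_type N) (v : 'rV[R]_k), sff_at SM SN g q v = 0) ->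
  (forall (q : set_type N) (v : 'rV[R]_k), v *m lorentz_force gN sN q *m dincl SM SN q =
    v *m dincl SM SN q *m lorentz_force g s (set_val q)) -> geodesics_included.
Proof.
move=> II0 Y I eta [oI iI seta geo]; split=> //.
  exact: (smooth_curve_map (smooth_set_val emb) oI seta).
move=> t It; have [-> ->] := incl_velocity_acceleration oI seta It.
by rewrite II0 addr0 geo // Y.
Qed.

(** The Gauss formula at time 0 for the magnetic geodesic of N with initial
    velocity [v]. *)
Lemma geodesics_included_decomposition : geodesics_included ->
  forall (q : set_type N) (v : 'rV[R]_k), exists a,
  v *m dincl SM SN q *m lorentz_force g s (set_val q) =
     a *m dincl SM SN q + sff_at SM SN g q v.
Proof.
move=> h2 q v; have [T T0 [eta [e0 v0 geo]]] := magnetic_geodesic_exists mgN q v ssN.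
have [oI iI seta geoN] := geo; have [_ _ _ geoM] := h2 _ _ geo.
have T_0 : `|0 : R| < T by rewrite normr0.
have [vE aE] := incl_velocity_acceleration oI seta T_0.
exists (acceleration SN gN eta 0); apply/esym.
by move: (geoM 0 T_0); rewrite vE aE v0 /= e0.
Qed.

(** The magnetic geodesic of M with initial velocity tangent to N stays in N
    for a short time. Its coordinates [x] in N are obtained from the local
    retraction, which makes them smooth, and the Gauss formula applies. *)
Lemma totally_magnetic_decomposition : totally_magnetic SM SN g s ->
  forall (q : set_type N) (v : 'rV[R]_k), exists a,
  v *m dincl SM SN q *m lorentz_force g s (set_val q) =
     a *m dincl SM SN q + sff_at SM SN g q v.
Proof.
move=> h1 q v.
have [T T0 [d [d0 v0 geo]]] := magnetic_geodesic_exists mg (set_val q) (v *m dincl SM SN q) ss.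
have [oI iI sd geoM] := geo; have T_0 : `|0 : R| < T by rewrite normr0.
have [|e e0 dN] := h1 _ _ geo T_0; first by exists q => //; exists v.
have ab := chart_at_atlas SN q; have ac := chart_at_atlas SM (set_val q).
have bq := chart_at_dom SN q; have cq := chart_at_dom SM (set_val q).
pose b := chart_at SN q; pose c := chart_at SM (set_val q).
have [psi [V [oV spsi Vq psiE]]] := local_retraction emb ab ac bq cq.
pose I' := ([set t | `|t| < T] `&` d @^-1` (cdom c `&` c @^-1` V)) `&` [set t | `|t| < e].
have oI' : open I'.
  apply: openI; last exact: open_norm_lt.
  apply: curve_preimage_open => //; first exact: sd.1.
  exact: chart_preimage_open.
have I'0 : I' 0 by split; [split=> //; rewrite /= d0|rewrite /= normr0].
pose x t := psi (c (d t)).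
have sx : Ck_on 2 I' x.
  have sz : Ck_on 2 I' (c \o d) by apply: Ck_on_subset (sd.2 c ac 2%N) => t [[? []]].
  by apply: (Ck_on_comp oI' oV _ sz (spsi 2%N)) => t [[_ []]].
have lift t : I' t -> exists p, [/\ set_val p = d t, cdom b p & x t = b p].
  move=> [[_ [ct Vt]] te]; have [|_ Nt] := dN t; first by rewrite -ltr_norml.
  pose p : set_type N := exist (fun x => x \in N) _ (mem_set Nt).
  have pE : set_val p = d t by [].
  have [] := psiE p; rewrite ?pE // => bp xE.
  by exists p.
have oU := @rep_dom_open _ _ _ _ _ _ b c (@set_val_continuous M N).
have xU t : I' t -> rep_dom set_val b c (x t).
  move=> It; have [p [pE bp ->]] := lift t It; apply: rep_dom_cmap => //.
  by rewrite pE; case: It => [[_ []]].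
have zE : \forall t \near (0 : R), (c \o d) t = coord_rep set_val b c (x t).
  apply: filterS (near_open oI' I'0) => t It; have [p [pE bp ->]] := lift t It.
  by rewrite /coord_rep /= cmapK // pE.
have x0 : x 0 = b q by rewrite /x d0; have [] := psiE q cq Vq.
have dphi : differentiable (coord_rep set_val b c) (x 0).
  by apply: ((smooth_set_val emb).2 b c ab ac 1%N).1; exact: xU.
have ct : cdom c (d 0) by rewrite d0.
have [vE aE] := acceleration_chart mg oI sd T_0 ac ct.
have vE' := velocity_comp (sx.1 0 I'0) dphi zE.
have aE' := coord_acc_comp (bform_coord SN b gN) (bform_coord SM c g) oI' I'0 sx oU
  ((smooth_set_val emb).2 b c ab ac 2%N) xU zE.
have D1 : dchart SM c (d 0) = 1%:M by rewrite d0; exact: dchart_chart_at.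
have J0 : 'J (coord_rep set_val b c) (x 0) = dincl SM SN q by rewrite x0.
have x'0 : derive1 x 0 = v.
  apply: (dincl_inj emb (q := q)).
  apply: etrans (congr1 (mulmx _) (esym J0)) _; apply: etrans (esym vE') _.
  apply: etrans vE _.
  apply: etrans (congr1 (mulmx _) D1) _.
  apply: etrans (mulmx1 _) _.
  exact: v0.
exists (coord_acc (bform_coord SN b gN) x 0).
move: aE'; rewrite aE D1 mulmx1 (geoM 0 T_0) v0 d0 x'0 x0.
exact.
Qed.

End Decomposition.

(** * Equations tangent to a coordinate subspace *)

Section InvariantSubspace.
Context {R : realType}.

(** Projects positions and velocities onto the subspace of the first [a]
    coordinates. *)
Definition slice_proj a b (s : 'rV[R]_((a + b) + (a + b))) : 'rV[R]_((a + b) + (a + b)) :=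
  row_mx (row_mx (lsubmx (lsubmx s)) 0) (row_mx (lsubmx (rsubmx s)) 0).

Lemma norm_row_mx_le a b (x : 'rV[R]_a) (y : 'rV[R]_b) (C : R) : 0 <= C ->
  `|row_mx x y| <= C <-> `|x| <= C /\ `|y| <= C.
Proof.
move=> C0; split=> [h|[hx hy]].
  have h' := (rV_norm_leP _ C0).1 h.
  split; apply/(rV_norm_leP _ C0) => j.
    by have := h' (lshift b j); rewrite row_mxEl.
  by have := h' (rshift a j); rewrite row_mxEr.
apply/(rV_norm_leP _ C0) => j; case: (split_ordP j) => l ->.
  by rewrite row_mxEl; exact: (rV_norm_leP _ C0).1.
by rewrite row_mxEr; exact: (rV_norm_leP _ C0).1.
Qed.

(** Let [w] collect the last [b] coordinates of the position and of the
    velocity. The last coordinates of [G] vanish at the projection of the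
    state onto the subspace, whose distance to the state is at most [|w|]. If
    [L] is a Lipschitz constant, [|w'| <= (L + 1) |w|], and [ode_vanish]
    applies. *)
Lemma second_order_invariant a b (U : set 'rV[R]_(a + b))
    (G : 'rV[R]_(a + b) -> 'rV[R]_(a + b) -> 'rV[R]_(a + b)) (I : set R)
    (z : R -> 'rV[R]_(a + b)) : open U ->
  smooth_on [set s : 'rV[R]_((a + b) + (a + b)) | U (lsubmx s)]
    (fun s => G (lsubmx s) (rsubmx s)) ->
  (forall y u : 'rV[R]_a, U (row_mx y 0) -> rsubmx (G (row_mx y 0) (row_mx u 0)) = 0) ->
  open I -> I 0 -> Ck_on 2 I z -> (forall t, I t -> U (z t)) ->
  (forall t, I t -> derive1 (derive1 z) t = G (z t) (derive1 z t)) ->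
  rsubmx (z 0) = 0 -> rsubmx (derive1 z 0) = 0 ->
  exists2 e : R, 0 < e & forall t, `|t| < e -> I t /\ rsubmx (z t) = 0.
Proof.
move=> oU sG G0 oI I0 hz zU zE z0 z'0.
have hd := Ck_on_derive1 hz.
pose W := [set s : 'rV[R]_((a + b) + (a + b)) | U (lsubmx s)].
have oW : open W by exact: open_lsubmx.
pose F (s : 'rV[R]_((a + b) + (a + b))) : 'rV[R]_b := rsubmx (G (lsubmx s) (rsubmx s)).
have sF : Ck_on 1 W F.
  apply/Ck_on_mxP => // i j; under [X in Ck_on _ _ X]eq_fun do rewrite mxE.
  exact: ((Ck_on_mxP _ _ oW).1 (sG 1%N)).
pose s t := row_mx (z t) (derive1 z t).
have W0 : W (s 0) by rewrite /W /= row_mxKl; exact: zU.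
have [r r0 [L L0 [rW rL]]] := locally_lipschitz oW W0 sF.
have ds t : I t -> differentiable s t.
  move=> It; have [d1 d2] := hd t It; apply/derivable1_diffP.
  have h1 : is_derive t (1 : R) z ('D_1 z t) by apply/derivableP/derivable1_diffP.
  have h2 : is_derive t (1 : R) (derive1 z) ('D_1 (derive1 z) t).
    by apply/derivableP/derivable1_diffP.
  by have [] := is_derive_row_mx h1 h2.
have : \forall t \near (0 : R), I t /\ `|s t - s 0| < r.
  have h1 := near_open oI I0.
  have h2 : \forall t \near (0 : R), `|s t - s 0| < r.
    have := differentiable_continuous (ds 0 I0).
    by move=> /cvgrPdistC_lt; exact.
  by apply: filterS2 h1 h2.
move=> /nbhs_ballP[T /= T0 hT].
have {}hT t : `|t| < T -> I t /\ `|s t - s 0| < r.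
  by move=> tT; apply: hT; rewrite -ball_normE /= sub0r normrN.
pose w t := row_mx (rsubmx (z t)) (rsubmx (derive1 z t)).
have w0 : w 0 = 0 by rewrite /w z0 z'0 row_mx0.
have dw t : `|t| < T -> is_derive t (1 : R) w (row_mx (rsubmx (derive1 z t)) (F (s t))).
  move=> /hT[It _]; have [d1 d2] := hd t It.
  rewrite /F /s row_mxKl row_mxKr -zE //.
  by apply: is_derive_row_mx; exact: derive1_rsubmx.
have Ps0 : slice_proj (s 0) = s 0.
  rewrite /slice_proj /s row_mxKl row_mxKr.
  rewrite -[in RHS](hsubmxK (z 0)) -[in RHS](hsubmxK (derive1 z 0)).
  by rewrite z0 z'0.
have sub_le t : `|s t - slice_proj (s t)| <= `|w t|.
  rewrite /slice_proj /s row_mxKl row_mxKr opp_row_mx add_row_mx.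
  have wn := normr_ge0 (w t); have [w1 w2] := (norm_row_mx_le _ _ wn).1 (lexx _).
  apply/(norm_row_mx_le _ _ wn); split.
    rewrite -[X in X - _](hsubmxK (z t)) opp_row_mx add_row_mx subrr subr0.
    by apply/(norm_row_mx_le _ _ wn); rewrite normr0.
  rewrite -[X in X - _](hsubmxK (derive1 z t)) opp_row_mx add_row_mx subrr subr0.
  by apply/(norm_row_mx_le _ _ wn); rewrite normr0.
(* Hence the projected state stays in the ball on which [F] is Lipschitz. *)
have proj_le t : `|slice_proj (s t) - s 0| <= `|s t - s 0|.
  have nn := normr_ge0 (s t - s 0).
  have := (norm_row_mx_le (z t - z 0) (derive1 z t - derive1 z 0) nn).1.
  rewrite -{1}add_row_mx -opp_row_mx -/(s t) -/(s 0) => /(_ (lexx _))[n1 n2].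
  move: nn n1 n2; generalize (`|s t - s 0|) => C nn n1 n2.
  rewrite -[in leLHS]Ps0 /slice_proj /s !row_mxKl !row_mxKr opp_row_mx add_row_mx.
  apply/(norm_row_mx_le _ _ nn); rewrite !opp_row_mx !add_row_mx !subr0.
  split; apply/(norm_row_mx_le _ _ nn); rewrite normr0; split=> //.
    have := (norm_row_mx_le (lsubmx (z t - z 0)) (rsubmx (z t - z 0)) nn).1.
    by rewrite hsubmxK => /(_ n1)[]; rewrite linearB.
  have := (norm_row_mx_le (lsubmx (derive1 z t - derive1 z 0))
    (rsubmx (derive1 z t - derive1 z 0)) nn).1.
  by rewrite hsubmxK => /(_ n2)[]; rewrite linearB.
have FP t : `|t| < T -> F (slice_proj (s t)) = 0.
  move=> /hT[_ sr]; have WP : W (slice_proj (s t)).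
    by apply: rW; exact: le_lt_trans (proj_le t) sr.
  by move: WP; rewrite /W /F /slice_proj /= row_mxKl row_mxKr => /G0; exact.
have bound t : `|t| < T -> `|row_mx (rsubmx (derive1 z t)) (F (s t))| <= (L + 1) * `|w t|.
  move=> tT; have [_ sr] := hT t tT; have wn := normr_ge0 (w t).
  have [w1 w2] := (norm_row_mx_le _ _ wn).1 (lexx _).
  apply/norm_row_mx_le; first by rewrite mulr_ge0 // addr_ge0 // ltW.
  split; first by apply: le_trans w2 _; rewrite mulrDl mul1r lerDr mulr_ge0 // ltW.
  rewrite -[F (s t)]subr0 -(FP t tT); apply: le_trans (rL _ _ sr _) _.
    exact: le_lt_trans (proj_le t) sr.
  apply: (@le_trans _ _ (L * `|w t|)); first by rewrite ler_pM2l.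
  by rewrite mulrDl lerDl mul1r.
have [|e e0 he] := ode_vanish T0 _ w0 dw bound; first by rewrite addr_gt0.
exists (Num.min T e); first by rewrite lt_min T0.
move=> t; rewrite lt_min => /andP[tT te]; split; first by case: (hT t tT).
by have := he t te; rewrite -row_mx0 => /eq_row_mx[].
Qed.

End InvariantSubspace.

(** * From geodesics of N to geodesics of M *)

Section TotallyMagnetic.
Context {R : realType} {M : topologicalType} {k m : nat}.
Variables (SM : @smooth_structure R M (k + m)) (N : set M).
Variable SN : @smooth_structure R (set_type N) k.
Hypothesis emb : embedded_submanifold SM SN.
Variables (g s : M -> 'M[R]_(k + m)).
Hypotheses (mg : riemannian_metric SM g) (ss : smooth_bform SM s).

Let gN := pullback SM SN g.
Let sN := pullback SM SN s.
Let mgN : riemannian_metric SN gN := riemannian_pullback emb mg.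
Let ssN : smooth_bform SN sN := smooth_pullback emb ss.

Let geodesics_included := forall (I : set R) (gamma : R -> set_type N),
    magnetic_geodesic SN gN sN I gamma ->
    magnetic_geodesic SM g s I (set_val \o gamma).

(** A magnetic geodesic of N through the given point, with the given velocity,
    is one of M. Its last [m] coordinates in the slice chart are constantly 0,
    hence so are those of its second derivative, which is the value of
    [mag_field]. *)
Lemma slice_mag_field q c b (y u : 'rV[R]_k) : geodesics_included -> slice_chart SM SN q c b ->
  cimg c (row_mx y (0 : 'rV[R]_m)) ->
  rsubmx (mag_field (bform_coord SM c g) (bform_coord SM c s) (row_mx y 0) (row_mx u 0)) = 0.
Proof.
move=> h2 sl yc; have [p bp bpy] := slice_lift sl yc; have [ac ab cq _ _] := sl.
have cp := (slice_dom sl p).1 bp.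
have [T T0 [eta [e0 v0 geo]]] := magnetic_geodesic_exists mgN p
  (u *m coord_frame SN b (b p)) ssN.
have [oI iI seta _] := geo; have [_ _ sM geoM] := h2 _ _ geo.
have T_0 : `|0 : R| < T by rewrite normr0.
pose z := c \o (set_val \o eta).
have ct : cdom c ((set_val \o eta) 0) by rewrite /= e0.
have /(magnetic_in_chart s mg oI sM T_0 ac ct) := geoM 0 T_0.
have [vE _] := acceleration_chart mg oI sM T_0 ac ct.
have [vN _] := incl_velocity_acceleration emb g oI seta T_0.
have z'0 : derive1 z 0 = row_mx u 0.
  apply: etrans vE _; rewrite vN v0 /= e0.
  apply: etrans (slice_velocity emb _ sl bp) _; congr row_mx.
  apply: etrans (esym (mulmxA _ _ _)) _.
  by apply: etrans (congr1 (mulmx u) (coord_frame_dchart ab bp)) _; rewrite mulmx1.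
have z0 : c ((set_val \o eta) 0) = row_mx y 0.
  by rewrite /= e0 (slice_coord sl bp) bpy.
rewrite z0 -/z z'0 => <-.
pose I' := [set t | `|t| < T] `&` eta @^-1` cdom b.
have oI' : open I' by apply: curve_preimage_open; [|exact: seta.1|exact: cdom_open].
have I'0 : I' 0 by split=> //=; rewrite e0.
have bc t : I' t -> cdom c (set_val (eta t)) by move=> [_ bt]; apply/(slice_dom sl).
have hz : Ck_on 2 I' z.
  by apply: Ck_on_subset (sM.2 c ac 2%N) => t It; split; [exact: It.1|exact: bc].
have hd := Ck_on_derive1 hz.
have rz t : I' t -> rsubmx (z t) = 0.
  by move=> [_ bt]; rewrite /z /= (slice_coord sl bt) row_mxKr.
have rz' t : I' t -> rsubmx (derive1 z t) = 0.
  move=> It; have [_ <-] := derive1_rsubmx (hd t It).1.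
  apply: etrans (near_eq_derive (g := fun=> 0) _ _) (derive_cst _ _ _).
  by apply: filterS (near_open oI' It) => r; exact: rz.
have [_ <-] := derive1_rsubmx (hd 0 I'0).2.
apply: etrans (near_eq_derive (g := fun=> 0) _ _) (derive_cst _ _ _).
by apply: filterS (near_open oI' I'0) => r; exact: rz'.
Qed.

Lemma totally_magnetic_of_geodesics_included : geodesics_included -> totally_magnetic SM SN g s.
Proof.
move=> h2 I gamma [oI iI sg geo] I0 [q q0 [u _ uE]].
have [c [b sl]] := emb q; have [ac ab cq hN _] := sl; have bq := slice_center sl.
pose z := c \o gamma; pose I' := I `&` gamma @^-1` cdom c.
have oI' : open I' by apply: curve_preimage_open; [|exact: sg.1|exact: cdom_open].
have c0 : cdom c (gamma 0) by rewrite -q0.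
have I'0 : I' 0 by [].
have hz : Ck_on 2 I' z := sg.2 c ac 2%N.
have sF := smooth_mag_field (@open_cimg _ _ _ c)
  (fun x cx => metric_coord_unit mg ac cx) ((let: And3 sg _ _ := mg in sg) c ac) (ss ac).
have [vE _] := acceleration_chart mg oI sg I0 ac c0.
have [||||e e0 he] := second_order_invariant (@open_cimg _ _ _ c) sF
    (fun y u => @slice_mag_field q c b y u h2 sl) oI' I'0 hz.
- by move=> t [_ ct]; exact: cdom_cimg.
- by move=> t [It ct]; apply/(magnetic_in_chart s mg oI sg It ac ct); exact: geo.
- by rewrite /z /= -q0 (slice_coord sl bq) row_mxKr.
- have -> : derive1 z 0 = row_mx (u *m dchart SN b q) 0.
    have uE' : velocity SM gamma 0 = u *m dincl SM SN q := esym uE.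
    by apply: etrans vE _; rewrite uE' -q0 (slice_velocity emb u sl bq).
  by rewrite row_mxKr.
exists e => // t te; have [|[It ct] zt] := he t; first by rewrite ltr_norml.
by split=> //; apply/(hN _ ct).
Qed.

End TotallyMagnetic.

Theorem theorem1p4 (R : realType) (M : topologicalType) (k m : nat)
    (SM : @smooth_structure R M (k + m))
    (M_hausdorff : hausdorff_space M)
    (M_compact : compact [set: M])
    (M_connected : connected [set: M])
    (gM sM : M -> 'M[R]_(k + m))
    (gM_metric : riemannian_metric SM gM)
    (sM_closed : closed_two_form SM sM)
    (N : set M) (SN : @smooth_structure R (set_type N) k)
    (N_compact : compact N)
    (N_embedded : embedded_submanifold SM SN) :
  let gN := pullback SM SN gM in
  let sN := pullback SM SN sM in
  let YM := lorentz_force gM sM in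
  let YN := lorentz_force gN sN in
  let dincl := dincl SM SN in
  let stmt1 := totally_magnetic SM SN gM sM in
  let stmt2 := forall (I : set R) (gamma : R -> set_type N),
    magnetic_geodesic SN gN sN I gamma ->
    magnetic_geodesic SM gM sM I (set_val \o gamma) in
  let II_vanishes := forall (q : set_type N) (v : 'rV[R]_k),
    second_fundamental_form SM SN gM q v = 0 in
  let stmt_a := forall (q : set_type N) (v : 'rV[R]_k),
    v *m YN q *m dincl q = v *m dincl q *m YM (set_val q) in
  let stmt_b := forall (q : set_type N) (v : 'rV[R]_(k + m)),
    tangent SM SN q v -> tangent SM SN q (v *m YM (set_val q)) in
  let stmt_c := forall (q : set_type N) (u v : 'rV[R]_(k + m)),
    tangent SM SN q u -> orthogonal_tangent SM SN gM q v ->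
    bform (sM (set_val q)) u v = 0 in
  [/\ stmt_a <-> stmt_b,
      stmt_b <-> stmt_c,
      stmt1 <-> stmt2 &
      stmt2 <-> II_vanishes /\ [\/ stmt_a, stmt_b | stmt_c]].
Proof.
have sg : smooth_bform SM gM by case: gM_metric.
have ss : smooth_bform SM sM by case: sM_closed.
move=> gN sN YM YN dincl stmt1 stmt2 II_vanishes stmt_a stmt_b stmt_c.
have ab : stmt_a -> stmt_b by exact: lorentz_equal_invariant.
have bc : stmt_b -> stmt_c by exact: (lorentz_invariant_orthogonal gM_metric).
have ca : stmt_c -> stmt_a by exact: (lorentz_orthogonal_equal N_embedded gM_metric).
have split_II : (forall (q : set_type N) (v : 'rV[R]_k), exists a,
      v *m dincl q *m YM (set_val q) = a *m dincl q + sff_at SM SN gM q v) ->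
    II_vanishes /\ stmt_a.
  move=> h; split=> q v.
    rewrite (second_fundamental_formE N_embedded).
    by have [] := normal_decomposition N_embedded gM_metric (h q) v.
  by have [] := normal_decomposition N_embedded gM_metric (h q) v.
have three_two : II_vanishes -> stmt_a -> stmt2.
  move=> hII ha; apply: (geodesics_included_of_extrinsic N_embedded) => // q v.
  by rewrite -(second_fundamental_formE N_embedded).
have one_three : stmt1 -> II_vanishes /\ stmt_a.
  by move=> h1; apply: split_II; exact: totally_magnetic_decomposition h1.
have two_three : stmt2 -> II_vanishes /\ stmt_a.
  by move=> h2; apply: split_II; exact: geodesics_included_decomposition h2.
split.
- by split=> [/ab//|/bc/ca].
- by split=> [/bc//|/ca/ab].
- split=> [/one_three[]|]; first exact: three_two.
  exact: totally_magnetic_of_geodesics_included.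
- split=> [/two_three[hII ha]|[hII hY]]; first by split=> //; exact: Or31.
  by apply: three_two => //; case: hY => [//|/bc/ca//|/ca//].
Qed.
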